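(* The closest pair among a dynamic set of $n$ objects can be maintained in time $O(n)$ per insertion or deletion, and $O(n^2)$ space.
   Context: Model of computation: one maintains a finite set of objects subject to insertions and deletions, together with a (symmetric) bivariate function $d(s,t)$ giving the distance between two objects. The values of $d$ are only assumed to be totally ordered; no triangle inequality or other property is assumed. Each object is stored in constant space, $d$ can be evaluated in constant time, and two distances can be compared in constant time. Maintaining the closest pair means that after each update the data structure provides a pair of distinct objects $s,t$ in the current set minimizing $d(s,t)$; if several pairs attain the minimum, any one of them may be returned. Here $n$ is the current number of objects. *)

(* Defs.v *)
From mathcomp Require Import all_boot all_order.

Set Implicit Arguments.
Unset Strict Implicit.
Unset Printing Implicit Defensive.

(* The model is a unit-cost RAM.  A program is a fixed finite text: it does not
   depend on the type [T] of objects, on the ordered type [D] of distances, or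
   on the number of objects.  Objects and distances are opaque: objects can
   only be copied, tested for identity and passed to the distance function;
   distances can only be copied and compared. *)

Inductive word_op := Add | Sub | Mul | Div.

(* Operands are register names, except in [Const], whose last argument is a
   literal.  [Read]/[Write] address memory through a register. *)
Inductive instruction :=
| Const    of nat & nat
| Move     of nat & nat
| Clear    of nat
| Arith    of word_op & nat & nat & nat
| Read     of nat & nat
| Write    of nat & nat
| Distance of nat & nat & nat.

Inductive test :=
| IsBlank    of nat
| WordLe     of nat & nat
| SameObject of nat & nat
| DistLe     of nat & nat.

Inductive command :=
| Skip
| Do    of instruction
| Seq   of command & command
| If    of test & command & command
| While of test & command.

Definition arith (o : word_op) : nat -> nat -> nat :=
  match o with Add => addn | Sub => subn | Mul => muln | Div => divn end.

(* [Blank] is the content of a register or memory cell that is not in use. *)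
Inductive value (T D : Type) :=
| Blank
| Word of nat
| Obj  of T
| Dist of D.
Arguments Blank {T D}.
Arguments Word {T D} _.
Arguments Obj {T D} _.
Arguments Dist {T D} _.

(* A program mentions only finitely many registers, so the registers account
   for a constant amount of storage. *)
Record state (T D : Type) := State {
  regs  : nat -> value T D;
  cells : nat -> value T D }.

Definition initial (T D : Type) : state T D :=
  State (fun=> Blank) (fun=> Blank).

Definition set_reg T D (s : state T D) (r : nat) (v : value T D) : state T D :=
  State [eta regs s with r |-> v] (cells s).

Definition set_cell T D (s : state T D) (a : nat) (v : value T D) : state T D :=
  State (regs s) [eta cells s with a |-> v].

(* Words have at most log2 (word + 1) bits, and the memory in use is an initial
   segment of at most [space] cells. *)
Definition fits T D (space word : nat) (s : state T D) : Prop :=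
  [/\ forall r w, regs s r = Word w -> w <= word,
      forall a w, cells s a = Word w -> w <= word
    & forall a, space <= a -> cells s a = Blank].

Section Semantics.
Variables (T : eqType) (disp : Order.disp_t) (D : orderType disp).
Variable d : T -> T -> D.

(* An ill-typed instruction or test has no result, and blocks execution. *)
Definition step (i : instruction) (s : state T D) : option (state T D) :=
  match i with
  | Const r n => Some (set_reg s r (Word n))
  | Move r x => Some (set_reg s r (regs s x))
  | Clear r => Some (set_reg s r Blank)
  | Arith o r x y =>
      match regs s x, regs s y with
      | Word m, Word n => Some (set_reg s r (Word (arith o m n)))
      | _, _ => None
      end
  | Read r x =>
      if regs s x is Word a then Some (set_reg s r (cells s a)) else None
  | Write x y =>
      if regs s x is Word a then Some (set_cell s a (regs s y)) else None
  | Distance r x y =>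
      match regs s x, regs s y with
      | Obj p, Obj q => Some (set_reg s r (Dist (d p q)))
      | _, _ => None
      end
  end.

Definition eval (b : test) (s : state T D) : option bool :=
  match b with
  | IsBlank x => Some (if regs s x is Blank then true else false)
  | WordLe x y =>
      match regs s x, regs s y with
      | Word m, Word n => Some (m <= n)
      | _, _ => None
      end
  | SameObject x y =>
      match regs s x, regs s y with
      | Obj p, Obj q => Some (p == q)
      | _, _ => None
      end
  | DistLe x y =>
      match regs s x, regs s y with
      | Dist u, Dist v => Some (u <= v)%O
      | _, _ => None
      end
  end.

(* [exec space word p s k s']: started in [s], the program [p] halts in [s']
   after exactly [k] unit-cost instructions and tests, and every state produced
   on the way respects the two bounds.  Execution is deterministic. *)
Inductive exec (space word : nat) :
  command -> state T D -> nat -> state T D -> Prop :=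
| exec_skip s :
    exec space word Skip s 0 s
| exec_do i s s' :
    step i s = Some s' -> fits space word s' ->
    exec space word (Do i) s 1 s'
| exec_seq p q s k s' l s'' :
    exec space word p s k s' -> exec space word q s' l s'' ->
    exec space word (Seq p q) s (k + l) s''
| exec_if b p q s v k s' :
    eval b s = Some v -> exec space word (if v then p else q) s k s' ->
    exec space word (If b p q) s k.+1 s'
| exec_while_stop b p s :
    eval b s = Some false ->
    exec space word (While b p) s 1 s
| exec_while_loop b p s k s' l s'' :
    eval b s = Some true -> exec space word p s k s' ->
    exec space word (While b p) s' l s'' ->
    exec space word (While b p) s (k + l).+1 s''.

Inductive update :=
| Insert of T
| Delete of T.

Definition updated (u : update) : T :=
  match u with Insert x => x | Delete x => x end.

(* The current set of objects is a duplicate-free sequence. *)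
Definition valid (A : seq T) (u : update) : bool :=
  match u with Insert x => x \notin A | Delete x => x \in A end.

Definition apply_update (A : seq T) (u : update) : seq T :=
  match u with Insert x => x :: A | Delete x => rem x A end.

Definition closest_pair (A : seq T) (x y : T) : Prop :=
  [/\ x \in A, y \in A, x != y
    & forall p q, p \in A -> q \in A -> p != q -> (d x y <= d p q)%O].

(* Calling convention: the object to insert or delete is passed in register 0,
   and the answer is returned in registers 1 and 2; all other registers and the
   memory are preserved between updates. *)
Definition call (u : update) (s : state T D) : state T D :=
  set_reg s 0 (Obj (updated u)).

Definition reports_closest_pair (A : seq T) (s : state T D) : Prop :=
  exists x y, [/\ regs s 1 = Obj x, regs s 2 = Obj y & closest_pair A x y].

(* In state [s], representing the set [A], the pair of programs [ins], [del]
   correctly processes the updates [us] one after the other.  The bounds for a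
   single update are functions of the number [n] of objects, the inserted or
   deleted one included; [space] and [word] bound the whole update, from its
   first state to its last.  So the memory used while the structure rests with
   [n] objects is at most [space n] before a deletion; cells released by
   deletions have to be blanked. *)
Fixpoint maintains (ins del : command) (time space word : nat -> nat)
    (A : seq T) (s : state T D) (us : seq update) : Prop :=
  if us is u :: us' then
    valid A u ->
    let A' := apply_update A u in
    let n := maxn (size A) (size A') in
    let p := if u is Insert _ then ins else del in
    exists (k : nat) (s' : state T D),
      [/\ fits (space n) (word n) (call u s),
          exec (space n) (word n) p (call u s) k s',
          k <= time n,
          1 < size A' -> reports_closest_pair A' s'
        & maintains ins del time space word A' s' us']
  else True.

End Semantics.

(* Main.v *)
Require Import Defs.
From mathcomp Require Import all_boot all_order zify.

(** The [n] objects sit at the leaves [n, ..., 2n-1] of the heap-shaped binary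
    tree in which node [v < n] has the children [2v] and [2v+1].  For all nodes
    [v <= u <= 2v+1] we store a closest pair among the pairs with one object
    below [u] and the other below [v].  These are the pairs of nodes reached
    from the pair [(1, 1)] by always splitting the smaller node, so an entry is
    the better one of the entries of [(2v, u)] and [(2v+1, u)], and the entry of
    [(1, 1)] is the answer.  A node [a] occurs in at most [2a+1] entries, so
    changing the object at one leaf affects O(n) entries: the sum over its
    ancestors is geometric.  Inserting turns leaf [n] into an internal node with
    the two new leaves [2n] and [2n+1]; deleting first moves the object of the
    last leaf into the freed one, and then undoes this.

    Consistency of the table (each entry equals the better of its two children)
    is a local condition.  While it is being restored, it can only fail for
    entries of nodes that are ancestors of a changed leaf and still to be
    visited. *)

Set Implicit Arguments.
Unset Strict Implicit.
Unset Printing Implicit Defensive.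

(** * Cost and correctness of programs *)

Declare Scope program_scope.
Delimit Scope program_scope with P.
Notation "p ;; q" := (Seq p q) (at level 60, right associativity) : program_scope.
Local Open Scope program_scope.

Fixpoint writes (p : command) (r : nat) : bool :=
  match p with
  | Skip => false
  | Do i =>
      match i with
      | Const x _ | Move x _ | Clear x | Arith _ x _ _ | Read x _
      | Distance x _ _ => r == x
      | Write _ _ => false
      end
  | Seq p q | If _ p q => writes p r || writes q r
  | While _ p => writes p r
  end.

(* Bounds the running time of loop-free programs only. *)
Fixpoint cost (p : command) : nat :=
  match p with
  | Skip => 0
  | Do _ => 1
  | Seq p q => cost p + cost q
  | If _ p q => (maxn (cost p) (cost q)).+1
  | While _ _ => 0
  end.

Section Logic.
Variables (T : eqType) (disp : Order.disp_t) (D : orderType disp).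
Variable d : T -> T -> D.
Variables space word : nat.
Implicit Types (s : state T D) (Q : state T D -> Prop).

Lemma fits_set_reg s r v : fits space word s ->
  (forall w, v = Word w -> w <= word) -> fits space word (set_reg s r v).
Proof.
case=> fr fc fb hv; split=> //= x w; case: eqP => _; [exact: hv|exact: fr].
Qed.

Lemma fits_set_cell s a v : fits space word s ->
  (forall w, v = Word w -> w <= word) -> a < space ->
  fits space word (set_cell s a v).
Proof.
case=> fr fc fb hv ha; split=> //= x.
  by move=> w; case: eqP => _; [exact: hv|exact: fc].
by move=> hx; rewrite gtn_eqF ?fb // (leq_trans ha).
Qed.

Lemma exec_frame p s k s' r : exec d space word p s k s' -> ~~ writes p r ->
  regs s' r = regs s r.
Proof.
elim=> {p s k s'} //=.
- have ne x (f : nat -> value T D) v : r != x -> [eta f with x |-> v] r = f r.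
    by move=> /= /negPf ->.
  case=> [x n|x y|x|o x y z|x y|x y|x y z] s s' /=.
  + by move=> [<-] _; apply: ne.
  + by move=> [<-] _; apply: ne.
  + by move=> [<-] _; apply: ne.
  + by case: (regs s y) => // m; case: (regs s z) => // n [<-] _; apply: ne.
  + by case: (regs s y) => // a [<-] _; apply: ne.
  + by case: (regs s x) => // a [<-] _.
  + by case: (regs s y) => // m; case: (regs s z) => // n [<-] _; apply: ne.
- by move=> p q s k s' l s'' _ IH1 _ IH2; rewrite negb_or => /andP[/IH1 <- /IH2 <-].
- by move=> b p q s [] k s' _ _ IH; rewrite negb_or => /andP[? ?]; exact: IH.
- by move=> b p s k s' l s'' _ _ IH1 _ IH2 h; rewrite IH2 // IH1.
Qed.

(* [vc p s Q] computes a sufficient condition for [p], which must be free of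
   loops, to run from [s] to a state that satisfies [Q]. *)
Fixpoint vc (p : command) s Q : Prop :=
  match p with
  | Skip => Q s
  | Do i =>
      match i with
      | Const r n => n <= word /\ Q (set_reg s r (Word n))
      | Move r x => Q (set_reg s r (regs s x))
      | Clear r => Q (set_reg s r Blank)
      | Arith o r x y =>
          match regs s x, regs s y with
          | Word m, Word n =>
              arith o m n <= word /\ Q (set_reg s r (Word (arith o m n)))
          | _, _ => False
          end
      | Read r x =>
          if regs s x is Word a then Q (set_reg s r (cells s a)) else False
      | Write x y =>
          if regs s x is Word a then a < space /\ Q (set_cell s a (regs s y))
          else False
      | Distance r x y =>
          match regs s x, regs s y with
          | Obj p, Obj q => Q (set_reg s r (Dist (d p q)))
          | _, _ => False
          end
      end
  | Seq p q => vc p s (fun s' => vc q s' Q)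
  | If b p q =>
      match eval b s with
      | Some true => vc p s Q
      | Some false => vc q s Q
      | None => False
      end
  | While _ _ => False
  end.

Lemma vc_seq p q s Q : vc p s (fun s' => vc q s' Q) -> vc (p ;; q) s Q.
Proof. by []. Qed.

Lemma vc_if b p q s v Q :
  eval b s = Some v -> vc (if v then p else q) s Q -> vc (If b p q) s Q.
Proof. by move=> /= ->; case: v. Qed.

(** Total correctness within time [t]. Since [exec] demands that every state produced fits, the
    space and word bounds come along. *)
Definition wp (p : command) s (t : nat) Q : Prop :=
  exists k s', [/\ exec d space word p s k s', k <= t & Q s'].

Lemma wp_weaken p s t t' Q Q' : wp p s t Q -> t <= t' ->
  (forall s', Q s' -> Q' s') -> wp p s t' Q'.
Proof.
by case=> k [s' [he ht hQ]] hle hw; exists k, s'; split; auto; apply: leq_trans hle.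
Qed.

Lemma wp_seq p q s t1 t2 Q :
  wp p s t1 (fun s' => wp q s' t2 Q) -> wp (p ;; q) s (t1 + t2) Q.
Proof.
case=> k [s1 [e1 h1 [l [s2 [e2 h2 hQ]]]]]; exists (k + l), s2; split=> //.
  exact: exec_seq e1 e2.
exact: leq_add.
Qed.

(** Specifications can thus name only what changes: a register that the program text never assigns
    is preserved, even across loops. *)
Lemma wp_frame p s t Q : wp p s t Q ->
  wp p s t (fun s' => Q s' /\ forall r, ~~ writes p r -> regs s' r = regs s r).
Proof.
case=> k [s' [he ht hQ]]; exists k, s'; split=> //; split=> // r.
exact: exec_frame he.
Qed.

(** Constants, arithmetic results and write addresses are checked by [vc]; all other instructions
    only copy words that already fit, or produce none. *)
Lemma wp_vc p s Q : fits space word s -> vc p s Q ->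
  wp p s (cost p) (fun s' => fits space word s' /\ Q s').
Proof.
elim: p s Q => [|i|p IHp q IHq|b p IHp q IHq|//] s Q fs /=.
- by move=> hQ; exists 0, s; split=> //; constructor.
- have [fr fc fb] := fs.
  have run s' : step d i s = Some s' -> fits space word s' -> Q s' ->
      wp (Do i) s 1 (fun s' => fits space word s' /\ Q s').
    by move=> hs hf hQ; exists 1, s'; split=> //; constructor.
  case: i run => [r n|r x|r|o r x y|r x|x y|r x y] run /=.
  + case=> hn hQ; apply: run hQ => //; apply: fits_set_reg => // w [<-] //.
  + by move=> hQ; apply: run hQ => //; apply: fits_set_reg => // w; apply: fr.
  + by move=> hQ; apply: run hQ => //; apply: fits_set_reg.
  + case ex: (regs s x) => [|m||] //; case ey: (regs s y) => [|n||] //.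
    case=> hn hQ; apply: run hQ; first by rewrite /= ex ey.
    by apply: fits_set_reg => // w [<-].
  + case ex: (regs s x) => [|m||] // hQ; apply: run hQ; first by rewrite /= ex.
    by apply: fits_set_reg => // w; apply: fc.
  + case ex: (regs s x) => [|m||] // [hm hQ]; apply: run hQ; first by rewrite /= ex.
    by apply: fits_set_cell => // w; apply: fr.
  + case ex: (regs s x) => [||m|] //; case ey: (regs s y) => [||n|] // hQ.
    by apply: run hQ; [rewrite /= ex ey|apply: fits_set_reg].
- move=> h; apply: wp_seq; apply: wp_weaken (IHp _ _ fs h) _ _ => // s' [fs' h'].
  exact: IHq.
- case eb: (eval b s) => [[]|] // h.
    have [k [s' [he hk hQ]]] := IHp _ _ fs h; exists k.+1, s'; split=> //.
      exact: (exec_if eb).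
    by rewrite ltnS (leq_trans hk) ?leq_maxl.
  have [k [s' [he hk hQ]]] := IHq _ _ fs h; exists k.+1, s'; split=> //.
    exact: (exec_if eb).
  by rewrite ltnS (leq_trans hk) ?leq_maxr.
Qed.

(* [I m s]: [m] is an upper bound on the time the loop still takes from [s]. *)
Lemma wp_while b p (I : nat -> state T D -> Prop) Q :
  (forall m s, I m s ->
    exists2 v, eval b s = Some v &
      if v then exists c, wp p s c (fun s' => exists2 m', I m' s' & c + m' < m)
      else 0 < m /\ Q s) ->
  forall m s, I m s -> wp (While b p) s m Q.
Proof.
move=> hI m; elim/ltn_ind: m => m IH s hm.
have [[] eb] := hI m s hm; last first.
  by case=> m0 hQ; exists 1, s; split=> //; exact: exec_while_stop.
case=> c [k [s1 [e1 h1 [m' I1 hc]]]].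
have [|l [s2 [e2 h2 hQ]]] := IH m' _ s1 I1.
  by apply: leq_ltn_trans hc; rewrite leq_addl.
exists (k + l).+1, s2; split=> //; first exact: (exec_while_loop eb e1 e2).
by apply: leq_ltn_trans hc; rewrite leq_add.
Qed.

End Logic.

(** * Recomputing one entry *)

(* Registers 0 to 2 belong to the calling convention.  Of the others only [rN],
   the number of objects, keeps its content between updates. *)
Notation rN := 3 (only parsing).
Notation rone := 4 (only parsing).
Notation rtwo := 5 (only parsing).
Notation rq := 6 (only parsing).
Notation ra := 7 (only parsing).
Notation rw := 8 (only parsing).
Notation rlo := 9 (only parsing).
Notation rb := 10 (only parsing).
Notation rs := 11 (only parsing).
Notation rX := 12 (only parsing).
Notation rY := 13 (only parsing).
Notation rX' := 14 (only parsing).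
Notation rY' := 15 (only parsing).
Notation radr := 16 (only parsing).
Notation rD := 17 (only parsing).
Notation rD' := 18 (only parsing).
Notation rt := 19 (only parsing).

Notation "'$' r '<-' x '[+]' y" := (Do (Arith Add r x y))
  (at level 50, x at level 9, y at level 9, r at level 9) : program_scope.
Notation "'$' r '<-' x '[-]' y" := (Do (Arith Defs.Sub r x y))
  (at level 50, x at level 9, y at level 9, r at level 9) : program_scope.
Notation "'$' r '<-' x '[*]' y" := (Do (Arith Mul r x y))
  (at level 50, x at level 9, y at level 9, r at level 9) : program_scope.
Notation "'$' r '<-' x '[/]' y" := (Do (Arith Div r x y))
  (at level 50, x at level 9, y at level 9, r at level 9) : program_scope.

(** The node with the smaller number, in [rs], is the one to be split. *)
Definition order_nodes : command :=
  If (WordLe ra rw) (Do (Move rb rw) ;; Do (Move rs ra))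
                    (Do (Move rb ra) ;; Do (Move rs rw)).

(** As [rs] never exceeds [rb] here, the test detects equality. A leaf paired with itself holds no
    two distinct objects, so that entry is blank. *)
Definition leaf_pair : command :=
  If (WordLe rb rs) (Do (Clear rX) ;; Do (Clear rY))
  ($ radr <- rb [*] rb ;; $ radr <- radr [*] rtwo ;; Do (Read rX radr) ;;
   $ radr <- rs [*] rs ;; $ radr <- radr [*] rtwo ;; Do (Read rY radr)).

(** For a pair in the table, [rb] is at most [2 * rs + 1]. So only the address for the child
    [2 * rs] needs a comparison; the child [2 * rs + 1] is always the larger node of its pair. *)
Definition load_children : command :=
  $ rt <- rs [*] rtwo ;;
  If (WordLe rb rt) ($ radr <- rt [*] rt ;; $ radr <- radr [+] rb)
                    ($ radr <- rb [*] rb ;; $ radr <- radr [+] rt) ;;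
  $ radr <- radr [*] rtwo ;; Do (Read rX radr) ;;
  $ radr <- radr [+] rone ;; Do (Read rY radr) ;;
  $ rt <- rt [+] rone ;; $ radr <- rt [*] rt ;; $ radr <- radr [+] rb ;;
  $ radr <- radr [*] rtwo ;; Do (Read rX' radr) ;;
  $ radr <- radr [+] rone ;; Do (Read rY' radr).

Definition select_closer : command :=
  If (IsBlank rX) (Do (Move rX rX') ;; Do (Move rY rY'))
  (If (IsBlank rX') Skip
   (Do (Distance rD rX rY) ;; Do (Distance rD' rX' rY') ;;
    If (DistLe rD rD') Skip (Do (Move rX rX') ;; Do (Move rY rY')))).

Definition store_pair : command :=
  $ radr <- rb [*] rb ;; $ radr <- radr [+] rs ;; $ radr <- radr [*] rtwo ;;
  Do (Write radr rX) ;; $ radr <- radr [+] rone ;; Do (Write radr rY).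

Definition refresh_pair : command :=
  order_nodes ;;
  If (WordLe rN rs) leaf_pair (load_children ;; select_closer) ;;
  store_pair ;; $ rw <- rw [-] rone.

(* The entry of a pair of nodes takes two adjacent cells.  Nodes are numbered
   from 1, so the cells of a pair [(u, 0)] are free for the object of leaf [u]. *)
Definition leaf_cell (u : nat) : nat := u * u * 2.
Definition pair_cell (u v : nat) : nat := (maxn u v * maxn u v + minn u v) * 2.

Section Refresh.
Variables (T : eqType) (disp : Order.disp_t) (D : orderType disp).
Variable d : T -> T -> D.

Definition pair_at (c : nat -> value T D) (u v : nat) : value T D * value T D :=
  (c (pair_cell u v), c (pair_cell u v).+1).

(** A blank entry counts as infinitely distant, and ties keep the first entry, exactly as in
    [select_closer]. *)
Definition closer (e e' : value T D * value T D) : value T D * value T D :=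
  match e, e' with
  | (Obj p, Obj q), (Obj p', Obj q') => if (d p q <= d p' q')%O then e else e'
  | (Obj _, Obj _), _ => e
  | _, _ => e'
  end.

Definition pair_value n (c : nat -> value T D) (u v : nat) :=
  if n <= minn u v then
    if u == v then (Blank, Blank)
    else (c (leaf_cell (maxn u v)), c (leaf_cell (minn u v)))
  else closer (pair_at c (minn u v).*2 (maxn u v))
              (pair_at c (minn u v).*2.+1 (maxn u v)).

(** Half-blank entries are excluded, so testing one component for blankness decides both. *)
Definition well_typed (e : value T D * value T D) : Prop :=
  e = (Blank, Blank) \/ exists p q, e = (Obj p, Obj q).

Variables space word N : nat.
(** [N] bounds the number of objects. Nodes stay below [2 * N], so addresses stay below twice the
    square of [2 * N]; the factor 100 leaves slack for intermediate words. *)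
Hypothesis hspace : 8 * N ^ 2 <= space.
Hypothesis hword : 100 * N.+1 ^ 2 <= word.

Implicit Types (s : state T D) (Q : state T D -> Prop).

Lemma vc_order_nodes a w s Q : regs s ra = Word a -> regs s rw = Word w ->
  Q (set_reg (set_reg s rb (Word (maxn a w))) rs (Word (minn a w))) ->
  vc d space word order_nodes s Q.
Proof. by move=> /= -> ->; case: leqP. Qed.

Lemma vc_leaf_pair a w s Q : a <= 2 * N -> w <= 2 * N ->
  regs s rtwo = Word 2 ->
  regs s rb = Word (maxn a w) -> regs s rs = Word (minn a w) ->
  (forall s', (forall r, r < rX -> regs s' r = regs s r) -> cells s' = cells s ->
    (regs s' rX, regs s' rY) =
       (if a == w then (Blank, Blank)
        else (cells s (leaf_cell (maxn a w)), cells s (leaf_cell (minn a w)))) ->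
    Q s') ->
  vc d space word leaf_pair s Q.
Proof.
move=> ha hw h2 hb hs hQ; rewrite /= hb hs.
have hle : (maxn a w <= minn a w) = (a == w) by lia.
rewrite hle; case: ifP hQ => haw hQ.
  (* Registers are numerals, so those below [rX], which is 12, are checked one by one. *)
  by apply: hQ => // r; do 12?[case: r => [|r] //].
(* Symbolic execution: each known register lets [vc] reduce one instruction further, leaving the
   word bounds as goals. *)
do ?[progress rewrite /= ?h2 ?hb ?hs].
have hM : maxn a w <= 2 * N by lia.
have hm : minn a w <= 2 * N by lia.
have b1 := leq_mul hM hM; have b2 := leq_mul hm hm.
move: (maxn a w) (minn a w) b1 b2 hQ {hM hm hb hs hle} => M m b1 b2 hQ.
do 4![split; first by nia].
by apply: hQ => // r; do 12?[case: r => [|r] //].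
Qed.

Lemma vc_load_children b m s Q : b <= 2 * N -> m.*2 < 2 * N -> m <= b <= m.*2.+1 ->
  regs s rone = Word 1 -> regs s rtwo = Word 2 ->
  regs s rb = Word b -> regs s rs = Word m ->
  (forall s', (forall r, r < rX -> regs s' r = regs s r) -> cells s' = cells s ->
    (regs s' rX, regs s' rY) = pair_at (cells s) m.*2 b ->
    (regs s' rX', regs s' rY') = pair_at (cells s) m.*2.+1 b ->
    Q s') ->
  vc d space word load_children s Q.
Proof.
move=> hb hm /andP[hmb hbm] h1 h2 rgb rgm hQ; do ?[progress rewrite /= ?h2 ?h1 ?rgb ?rgm ?addn1].
rewrite muln2; have hm' : m.*2.+1 <= 2 * N by lia.
have b1 := leq_mul hm' hm'; have b2 := leq_mul hb hb.
split; first by nia.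
have e2 : pair_cell m.*2.+1 b = (m.*2.+1 * m.*2.+1 + b) * 2.
  by congr ((_ * _ + _) * 2); lia.
rewrite /pair_at e2 in hQ; case: (leqP b m.*2) => hl.
  have e1 : pair_cell m.*2 b = (m.*2 * m.*2 + b) * 2.
    by congr ((_ * _ + _) * 2); lia.
  rewrite e1 in hQ; do ?[progress rewrite /= ?h2 ?h1 ?rgb ?addn1].
  do 9![split; first by nia].
  by apply: hQ => // r; do 12?[case: r => [|r] //].
have e1 : pair_cell m.*2 b = (b * b + m.*2) * 2.
  by congr ((_ * _ + _) * 2); lia.
rewrite e1 in hQ; do ?[progress rewrite /= ?h2 ?h1 ?rgb ?addn1].
do 9![split; first by nia].
by apply: hQ => // r; do 12?[case: r => [|r] //].
Qed.

Lemma vc_select_closer e e' s Q : well_typed e -> well_typed e' ->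
  (regs s rX, regs s rY) = e -> (regs s rX', regs s rY') = e' ->
  (forall s', (forall r, r < rX -> regs s' r = regs s r) -> cells s' = cells s ->
    (regs s' rX, regs s' rY) = closer e e' -> Q s') ->
  vc d space word select_closer s Q.
Proof.
move=> [->|[p [q ->]]] he' [hX hY] hE' hQ; rewrite /= hX.
  apply: hQ => //=.
  by move=> r; do 12?[case: r => [|r] //].
case: he' hE' hQ => [->|[p' [q' ->]]] [hX' hY'] hQ; rewrite /= hX'.
  by apply: hQ => //; rewrite hX hY.
do ?[progress rewrite /= ?hY ?hX' ?hY']; case: ifP => hc; apply: hQ => //=; rewrite ?hX ?hY ?hX' ?hY' ?hc //.
  by move=> r; do 12?[case: r => [|r] //].
by move=> r; do 12?[case: r => [|r] //].
Qed.

Lemma vc_store_pair a w s Q : a < 2 * N -> w < 2 * N ->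
  regs s rone = Word 1 -> regs s rtwo = Word 2 ->
  regs s rb = Word (maxn a w) -> regs s rs = Word (minn a w) ->
  (forall s', (forall r, r < rX -> regs s' r = regs s r) ->
    (forall e, cells s' e = if e == (pair_cell a w).+1 then regs s rY
                            else if e == pair_cell a w then regs s rX
                            else cells s e) -> Q s') ->
  vc d space word store_pair s Q.
Proof.
move=> ha hw h1 h2 hb hs hQ; do ?[progress rewrite /= ?h2 ?h1 ?hb ?hs ?addn1].
rewrite -/(pair_cell a w).
have hM : maxn a w < 2 * N by lia.
have hm : minn a w <= maxn a w by lia.
have : pair_cell a w < 8 * N ^ 2 - 1.
  rewrite /pair_cell; have := leq_mul hM hM; nia.
have : maxn a w * maxn a w + minn a w <= pair_cell a w by rewrite /pair_cell; nia.
move: hQ; move: (pair_cell a w) => A hQ b1 b2.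
do 6![split; first by nia].
by apply: hQ => // r; do 12?[case: r => [|r] //].
Qed.

(** The two inequalities between [a] and [w] say that the pair belongs to the table. Well-typed
    entries keep the distance instructions from blocking. *)
Lemma wp_refresh_pair n a w s : 0 < a < 2 * n -> 0 < w < 2 * n -> n <= N ->
  a <= w.*2.+1 -> w <= a.*2.+1 ->
  fits space word s ->
  (forall u v, 0 < u -> 0 < v -> well_typed (pair_at (cells s) u v)) ->
  regs s rN = Word n -> regs s rone = Word 1 -> regs s rtwo = Word 2 ->
  regs s ra = Word a -> regs s rw = Word w ->
  wp d space word refresh_pair s (cost refresh_pair) (fun s' =>
    [/\ fits space word s',
        regs s' rw = Word w.-1 &
        forall e, cells s' e =
          if e == (pair_cell a w).+1 then (pair_value n (cells s) a w).2
          else if e == pair_cell a w then (pair_value n (cells s) a w).1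
          else cells s e]).
Proof.
move=> /andP[a0 an] /andP[w0 wn] nN haw hwa fs wt hN h1 h2 ha hw.
suff /(wp_vc fs) : vc d space word refresh_pair s (fun s' =>
    regs s' rw = Word w.-1 /\ forall e, cells s' e =
          if e == (pair_cell a w).+1 then (pair_value n (cells s) a w).2
          else if e == pair_cell a w then (pair_value n (cells s) a w).1
          else cells s e).
  by move=> h; apply: wp_weaken h _ _ => // s' [? [? ?]]; split.
apply: vc_seq; apply: (vc_order_nodes ha hw); set s1 := set_reg _ _ _.
have k1 r : r < rb -> regs s1 r = regs s r by do 10?[case: r => [|r] //].
have finish s2 : (forall r, r < rX -> regs s2 r = regs s1 r) -> cells s2 = cells s ->
    (regs s2 rX, regs s2 rY) = pair_value n (cells s) a w ->
    vc d space word (store_pair ;; $ rw <- rw [-] rone) s2 (fun s' =>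
    regs s' rw = Word w.-1 /\ forall e, cells s' e =
          if e == (pair_cell a w).+1 then (pair_value n (cells s) a w).2
          else if e == pair_cell a w then (pair_value n (cells s) a w).1
          else cells s e).
  move=> k2 c2 e2; apply: vc_seq; apply: (@vc_store_pair a w);
    [lia|lia|by rewrite k2 // k1|by rewrite k2 // k1|by rewrite k2|by rewrite k2|].
  move=> s3 k3 c3; rewrite /= !k3 // !k2 // !k1 // hw h1 /=; split; first by nia.
  by rewrite subn1 -e2; split=> //; rewrite -c2.
apply: vc_seq; apply: (@vc_if _ _ _ _ _ _ _ _ _ _ (n <= minn a w)).
  by rewrite /= hN.
case: ifP => hn.
  apply: (@vc_leaf_pair a w) => //; try lia.
  by move=> s2 k2 c2 e2; apply: finish => //; rewrite e2 /pair_value hn.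
apply: vc_seq; apply: (@vc_load_children (maxn a w) (minn a w)) => //; try lia.
move=> s2 k2 c2 e2 e2'; apply: vc_select_closer e2 e2' _; try (apply: wt; lia).
move=> s3 k3 c3 e3; apply: finish; last by rewrite e3 /pair_value hn.
- by move=> r hr; rewrite k3 ?k2.
- by rewrite c3 c2.
Qed.

End Refresh.

(** * Recomputing the entries of a leaf and its ancestors *)

(** The partners of a node [a] in the table run from [maxn 1 (a %/ 2)] to the minimum of [2 * a + 1]
    and [2 * n - 1]. *)
Definition node_range : command :=
  $ rlo <- ra [/] rtwo ;; If (WordLe rone rlo) Skip (Do (Move rlo rone)) ;;
  $ rw <- ra [*] rtwo ;; $ rw <- rw [+] rone ;; $ rt <- rN [*] rtwo ;;
  If (WordLe rt rw) ($ rw <- rt [-] rone) Skip.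

(** Partners are treated in decreasing order: for [w <= a] the entry of [(a, w)] is computed from
    those of [a] with [2 * w] and [2 * w + 1], which come earlier. *)
Definition refresh_node : command :=
  node_range ;; While (WordLe rlo rw) refresh_pair.

Definition refresh_path : command :=
  While (WordLe rone ra) (refresh_node ;; $ ra <- ra [/] rtwo).

Lemma pair_cellC u v : pair_cell u v = pair_cell v u.
Proof. by rewrite /pair_cell maxnC minnC. Qed.

(** With [m <= M], the number [M * M + m] lies between consecutive squares, which determines first
    [M] and then [m]. *)
Lemma pair_cell_inj u v u' v' : pair_cell u v = pair_cell u' v' ->
  (u = u' /\ v = v') \/ (u = v' /\ v = u').
Proof.
rewrite /pair_cell => h.
have {h} : maxn u v * maxn u v + minn u v = maxn u' v' * maxn u' v' + minn u' v'.
  by lia.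
have : minn u v <= maxn u v by lia.
have : minn u' v' <= maxn u' v' by lia.
case: (ltngtP (maxn u v) (maxn u' v')) => [h|h|h]; [nia|nia|].
by rewrite h => _ _ h'; lia.
Qed.

(** The first cell of an entry has an even address, the second an odd one. *)
Lemma pair_cell_neqS u v u' v' : pair_cell u v <> (pair_cell u' v').+1.
Proof. rewrite /pair_cell; lia. Qed.

Lemma leaf_cellE u : leaf_cell u = pair_cell u 0.
Proof. by rewrite /leaf_cell /pair_cell maxn0 minn0 addn0. Qed.

(** Reflexive by [k = 0]. Large [k] give 0, which is not a node; nodes are therefore required to be
    positive where this matters. *)
Definition ancestor (a x : nat) : Prop := exists k, x = a %/ 2 ^ k.

Lemma ancestor_refl a : ancestor a a.
Proof. by exists 0; rewrite divn1. Qed.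

Lemma ancestorS a x : ancestor (a %/ 2) x -> ancestor a x.
Proof. by case=> k ->; exists k.+1; rewrite expnS divnMA. Qed.

Lemma ancestorE a x : ancestor a x -> x = a \/ ancestor (a %/ 2) x.
Proof.
case=> [[|k]] ->; first by left; rewrite divn1.
by right; exists k; rewrite expnS divnMA.
Qed.

Section Path.
Variables (T : eqType) (disp : Order.disp_t) (D : orderType disp).
Variable d : T -> T -> D.
Implicit Types (c : nat -> value T D) (s : state T D).

(** The bounds select one ordering, [v <= u], of each unordered pair in the table. *)
Definition consistent n c (stale : nat -> nat -> Prop) : Prop :=
  forall u v, 0 < v -> v <= u <= v.*2.+1 -> u < 2 * n -> ~ stale u v ->
    pair_at c u v = pair_value d n c u v.

(* The entries possibly wrong when the loop over the ancestors of a leaf has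
   reached [a], and its inner loop still has to treat the partners below [k].
   [X] are the ancestors of another changed leaf. *)
Definition stale_at (X : nat -> Prop) a k u v : Prop :=
  [\/ X u \/ X v, ancestor (a %/ 2) u \/ ancestor (a %/ 2) v,
      u = a /\ v < k | v = a /\ u < k].

Lemma pair_atC c u v : pair_at c u v = pair_at c v u.
Proof. by rewrite /pair_at pair_cellC. Qed.

Lemma pair_valueC n c u v : pair_value d n c u v = pair_value d n c v u.
Proof. by rewrite /pair_value maxnC minnC eq_sym. Qed.

(** * Effect of rewriting one entry *)

Section Write.
Variables (n a w : nat) (c c' : nat -> value T D).
Hypotheses (a0 : 0 < a) (w0 : 0 < w).
Let e := pair_value d n c a w.
Hypothesis hc : forall x, c' x =
  if x == (pair_cell a w).+1 then e.2 else if x == pair_cell a w then e.1 else c x.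

Lemma write_leaf u : c' (leaf_cell u) = c (leaf_cell u).
Proof.
rewrite hc leaf_cellE; case: eqP => [/pair_cell_neqS//|_].
by case: eqP => // /pair_cell_inj; lia.
Qed.

Lemma write_pair_at u v :
  pair_at c' u v = if pair_cell u v == pair_cell a w then e else pair_at c u v.
Proof.
rewrite /pair_at !hc eqSS; case: eqP => [/pair_cell_neqS//|_].
case: eqP => h; first by case: (e).
by case: eqP => // h'; case: (@pair_cell_neqS a w u v).
Qed.

Lemma write_pair_value u v :
  pair_cell (minn u v).*2 (maxn u v) <> pair_cell a w ->
  pair_cell (minn u v).*2.+1 (maxn u v) <> pair_cell a w ->
  pair_value d n c' u v = pair_value d n c u v.
Proof.
by move=> /eqP/negPf h1 /eqP/negPf h2; rewrite /pair_value !write_leaf !write_pair_at h1 h2.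
Qed.

(** The rewritten entry becomes correct, and only entries computed from it can be spoilt. Those
    involve either the parent of [a] or [a] with a partner smaller than [w], and both kinds are
    still stale. *)
Lemma consistent_write X :
  consistent n c (stale_at X a w.+1) -> consistent n c' (stale_at X a w).
Proof.
move=> h u v v0 uv un ns; rewrite write_pair_at; case: eqP => [eq|ne].
  have hs : e = pair_value d n c u v.
    by case: (pair_cell_inj eq) => [[-> ->]|[-> ->]] //; rewrite pair_valueC.
  (* Splitting a node increases the sum of the two node numbers, so the entry is not one of its own
     children and its prescribed value survives the write. *)
  have {}eq : u + v = a + w by case: (pair_cell_inj eq); lia.
  by rewrite hs write_pair_value // => /pair_cell_inj; lia.
rewrite h //.
  have hmin : minn u v = v by lia.
  have hmax : maxn u v = u by lia.
  have up i : a = v.*2 + i -> i < 2 -> False.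
    move=> ha hi; apply: ns; apply: Or42; right; have -> : v = a %/ 2 by lia.
    exact: ancestor_refl.
  have dn : u = a -> v < w -> False by move=> *; apply: ns; apply: Or43.
  rewrite write_pair_value // hmin hmax => /pair_cell_inj [[h1 h2]|[h1 h2]].
  - by apply: (up 0); lia.
  - by apply: dn; lia.
  - by apply: (up 1); lia.
  - by apply: dn; lia.
(* Of the entries stale before the write, only that of [(a, w)] itself leaves the stale set, and
   [ne] excludes it. *)
case=> [hx|hx|[h1]|[h1]]; first by apply: ns; apply: Or41.
- by apply: ns; apply: Or42.
- rewrite ltnS leq_eqVlt => /orP[/eqP h2|h2]; last by apply: ns; apply: Or43.
  by apply: ne; rewrite h1 h2.
- rewrite ltnS leq_eqVlt => /orP[/eqP h2|h2]; last by apply: ns; apply: Or44.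
  by apply: ne; rewrite h1 h2 pair_cellC.
Qed.

End Write.

(** This [w] is the largest partner of [a], so all entries of [a] have a partner below [w.+1]. *)
Lemma consistent_node_start X n a w c : 0 < a -> w = minn a.*2.+1 (2 * n).-1 ->
  consistent n c (fun u v => [\/ X u, X v, ancestor a u | ancestor a v]) ->
  consistent n c (stale_at X a w.+1).
Proof.
move=> a0 hw h u v v0 uv un ns; apply: h => // hx; apply: ns.
case: hx => [hx|hx|/ancestorE[hx|hx]|/ancestorE[hx|hx]].
- by apply: Or41; left.
- by apply: Or41; right.
- by apply: Or43; lia.
- by apply: Or42; left.
- by apply: Or44; lia.
- by apply: Or42; right.
Qed.

(** No partner of [a] lies below [maxn 1 (a %/ 2)], so nothing of [a] itself is stale any more; only
    its proper ancestors remain. *)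
Lemma consistent_node_end X n a w c : 0 < a -> w < maxn 1 (a %/ 2) ->
  consistent n c (stale_at X a w.+1) ->
  consistent n c (fun u v =>
    [\/ X u, X v, ancestor (a %/ 2) u | ancestor (a %/ 2) v]).
Proof.
move=> a0 hw h u v v0 uv un ns; apply: h => // hx; apply: ns.
case: hx => [[hx|hx]|[hx|hx]|hx|hx]; try by [apply: Or41|apply: Or42|apply: Or43|apply: Or44].
  lia.
lia.
Qed.

(** Memory without words meets every word bound. This matters because the bound follows the current
    number of objects, which may shrink. *)
Definition no_word (v : value T D) : bool :=
  match v with Blank | Obj _ => true | _ => false end.

Record heap_mem n c : Prop := HeapMem {
  heap_pair : forall u v, 0 < u -> 0 < v -> well_typed (pair_at c u v);
  heap_leaf : forall i, n <= i < 2 * n -> exists x, c (leaf_cell i) = Obj x;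
  heap_no_word : forall e, no_word (c e);
  heap_blank : forall e, 8 * n ^ 2 <= e -> c e = Blank }.

Lemma closer_typed e e' : well_typed e -> well_typed e' -> well_typed (closer d e e').
Proof.
by case=> [->|[p [q ->]]] // h'; case: (h') => [->|[p' [q' ->]]] /=;
  [right; exists p, q|case: ifP => _; right; [exists p, q|exists p', q']].
Qed.

Lemma pair_value_typed n c u v : 0 < u < 2 * n -> 0 < v < 2 * n -> heap_mem n c ->
  well_typed (pair_value d n c u v).
Proof.
move=> hu hv [hp hl _ _]; rewrite /pair_value; case: ifP => hn.
  case: ifP => huv; first by left.
  have [|x ->] := hl (maxn u v); first by lia.
  have [|y ->] := hl (minn u v); first by lia.
  by right; exists x, y.
by apply: closer_typed; apply: hp; lia.
Qed.

Lemma heap_mem_write n a w c c' : 0 < a < 2 * n -> 0 < w < 2 * n ->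
  (forall x, c' x = if x == (pair_cell a w).+1 then (pair_value d n c a w).2
     else if x == pair_cell a w then (pair_value d n c a w).1 else c x) ->
  heap_mem n c -> heap_mem n c'.
Proof.
move=> ha hw hc hm; have he := pair_value_typed ha hw hm.
have [a0 w0] : 0 < a /\ 0 < w by lia.
case: (hm) => hp hl hn hb; split.
- by move=> u v u0 v0; rewrite (write_pair_at hc); case: ifP => _ //; apply: hp.
- by move=> i hi; rewrite (write_leaf _ _ hc) //; apply: hl.
- by move=> x; rewrite hc; case: he => [->|[p [q ->]]] /=; do !case: ifP.
- move=> x hx.
  have : (pair_cell a w).+1 < 8 * n ^ 2.
    have hM : maxn a w < 2 * n by lia.
    have : minn a w <= maxn a w by lia.
    by rewrite /pair_cell; have := leq_mul hM hM; nia.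
  move=> hp'; rewrite hc hb //.
  by have [-> ->] : x == (pair_cell a w).+1 = false /\ x == pair_cell a w = false by lia.
Qed.

Variables space word N : nat.
Hypothesis hspace : 8 * N ^ 2 <= space.
Hypothesis hword : 100 * N.+1 ^ 2 <= word.

Definition constants n s : Prop :=
  [/\ regs s rN = Word n, regs s rone = Word 1 & regs s rtwo = Word 2].

Definition same_leaves c c' : Prop := forall i, c' (leaf_cell i) = c (leaf_cell i).

(** There are at most [2 * a + 1] partners, each of constant cost; [180 * a] absorbs this and the
    computation of the range. *)
Lemma wp_refresh_node X n a s : n <= N -> 0 < a < 2 * n ->
  fits space word s -> constants n s -> regs s ra = Word a ->
  heap_mem n (cells s) ->
  consistent n (cells s) (fun u v => [\/ X u, X v, ancestor a u | ancestor a v]) ->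
  wp d space word refresh_node s (180 * a) (fun s' =>
    [/\ fits space word s', heap_mem n (cells s'),
        same_leaves (cells s) (cells s') &
        consistent n (cells s') (fun u v =>
          [\/ X u, X v, ancestor (a %/ 2) u | ancestor (a %/ 2) v])]).
Proof.
move=> hn /andP[a0 ha] fs cs rga hm hc; have [c1 c2 c3] := cs.
set K := cost refresh_pair.
set w0 := minn a.*2.+1 (2 * n).-1.
have run1 : vc d space word node_range s (fun s' =>
  [/\ constants n s', regs s' ra = Word a, regs s' rlo = Word (maxn 1 (a %/ 2)),
    regs s' rw = Word w0 & cells s' = cells s]).
  do ?[progress rewrite /= ?rga ?c1 ?c2 ?c3].
  split; first by nia.
  have e1 : w0 = if n * 2 <= a * 2 + 1 then n * 2 - 1 else a * 2 + 1.
    by rewrite /w0; case: leqP; lia.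
  have m2 : maxn 1 (a %/ 2) = if 1 <= a %/ 2 then a %/ 2 else 1 by case: leqP; lia.
  rewrite m2 e1.
  by case: (leqP 1 (a %/ 2)) => h1; case: (leqP (n * 2) (a * 2 + 1)) => h2;
     do ?[split; first by nia]; rewrite ?rga ?c1 ?c2 ?c3.
apply: wp_weaken (_ : wp d space word refresh_node s
  (cost node_range + ((w0.+1 - maxn 1 (a %/ 2)) * K.+1).+1) _) _ _; last first.
- by move=> s'; exact.
- have -> : cost node_range = 8 by [].
  by rewrite /K [cost _]/= /w0; lia.
apply: wp_seq; apply: wp_weaken (wp_vc fs run1) (leqnn _) _.
move=> s1 [fs1 [cs1 rga1 rlo1 rgw1 ec1]].
(* [w] is the next partner. Each remaining pass costs [K] and one test; the last [.+1] pays for the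
   test that fails. *)
pose I m s' := exists w c, [/\ [/\ w < 2 * n, w <= a.*2.+1 & m = ((w.+1 - maxn 1 (a %/ 2)) * K.+1).+1],
  [/\ fits space word s', constants n s', regs s' ra = Word a,
    regs s' rlo = Word (maxn 1 (a %/ 2)) & regs s' rw = Word w],
  cells s' = c, heap_mem n c /\ same_leaves (cells s) c &
  consistent n c (stale_at X a w.+1)].
apply: (@wp_while _ _ _ d space word _ _ I) => [m s2|]; last first.
  exists w0, (cells s); split=> //; first by split=> //; lia.
  exact: consistent_node_start hc.
case=> w [c [[hw1 hw2 ->] [fs2 cs2 rga2 rlo2 rgw2] ec2 [hm2 sl2] hc2]].
exists (maxn 1 (a %/ 2) <= w); first by rewrite /= rgw2 rlo2.
case: (leqP (maxn 1 (a %/ 2)) w) => hlo; last first.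
  split=> //; rewrite ec2; split=> //; exact: consistent_node_end hc2.
have [d1 d2 d3] := cs2.
have hp : forall u v, 0 < u -> 0 < v -> well_typed (pair_at (cells s2) u v).
  by rewrite ec2; exact: heap_pair hm2.
have [r1 r2 r3 r4 r5] : [/\ 0 < a < 2 * n, 0 < w < 2 * n, a <= w.*2.+1, w <= a.*2.+1 & 0 < a] by split; lia.
have := wp_frame (wp_refresh_pair d hspace hword r1 r2 hn r3 r4 fs2 hp d1 d2 d3 rga2 rgw2).
rewrite -/K => hrun; exists K; apply: wp_weaken hrun (leqnn _) _.
move=> s3 [[fs3 rgw3 ec3] fr].
exists ((w.-1.+1 - maxn 1 (a %/ 2)) * K.+1).+1; last first.
  have -> : w.+1 - maxn 1 (a %/ 2) = (w.-1.+1 - maxn 1 (a %/ 2)).+1 by lia.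
  by rewrite mulSn; lia.
rewrite ec2 in ec3.
exists w.-1, (cells s3); split=> //.
- by split; lia.
- by split=> //; rewrite ?fr //; split; rewrite fr.
- split; first exact: heap_mem_write ec3 hm2.
  by move=> i; rewrite -sl2 (write_leaf _ _ ec3) //; lia.
- by rewrite prednK; [apply: consistent_write ec3 _ hc2|]; lia.
Qed.

(** The geometric sum: one node costs about [180 * a], and the bound for [a %/ 2] is about
    [200 * a], together within [400 * a]. Entries of [X] may stay wrong, so two paths can be
    repaired in turn. *)
Lemma wp_refresh_path X n a s : n <= N -> a <= (2 * n).-1 ->
  fits space word s -> constants n s -> regs s ra = Word a ->
  heap_mem n (cells s) ->
  consistent n (cells s) (fun u v => [\/ X u, X v, ancestor a u | ancestor a v]) ->
  wp d space word refresh_path s (400 * a).+1 (fun s' =>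
    [/\ fits space word s', heap_mem n (cells s'),
        same_leaves (cells s) (cells s') &
        consistent n (cells s') (fun u v => X u \/ X v)]).
Proof.
move=> hn ha fs cs rga hm hc.
pose I m s' := exists a', [/\ a' <= (2 * n).-1, m = (400 * a').+1,
  [/\ fits space word s', constants n s' & regs s' ra = Word a'],
  heap_mem n (cells s') /\ same_leaves (cells s) (cells s') &
  consistent n (cells s') (fun u v => [\/ X u, X v, ancestor a' u | ancestor a' v])].
apply: (@wp_while _ _ _ d space word _ _ I) => [m s1|]; last by exists a.
case=> a1 [ha1 -> [fs1 cs1 rga1] [hm1 sl1] hc1].
have [c1 c2 c3] := cs1.
exists (1 <= a1); first by rewrite /= rga1 c2.
case: (ltnP 0 a1) => a0; last first.
  split=> //; split=> // u v v0 uv un ns; apply: hc1 => // h; apply: ns.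
  (* At the exit [a1] is 0, whose only ancestor is 0, so no entry is stale on its account. *)
  have z x : ancestor a1 x -> x = 0.
    by case=> k ->; move: a0; rewrite leqn0 => /eqP ->; rewrite div0n.
  by case: h => [||/z ?|/z ?]; [left|right|exfalso; lia|exfalso; lia].
exists (180 * a1 + 1); apply: wp_seq.
apply: wp_weaken (wp_frame (wp_refresh_node hn _ fs1 cs1 rga1 hm1 hc1)) _ _; [lia|lia|].
move=> s2 [[fs2 hm2 sl2 hc2] fr].
have e1 : regs s2 rN = Word n by rewrite fr.
have e2 : regs s2 rone = Word 1 by rewrite fr.
have e3 : regs s2 rtwo = Word 2 by rewrite fr.
have e4 : regs s2 ra = Word a1 by rewrite fr.
have := @wp_vc _ _ _ d space word ($ ra <- ra [/] rtwo) s2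
  (fun s' => regs s' ra = Word (a1 %/ 2) /\ cells s' = cells s2) fs2.
case; first by rewrite /= e3 e4; split=> //; nia.
move=> k [s3 [ex hk [fs3 [e5 e6]]]].
exists k, s3; split=> //; exists (400 * (a1 %/ 2)).+1; last by lia.
exists (a1 %/ 2); rewrite !e6; split=> //; first by lia.
  by split=> //; split; rewrite (exec_frame ex).
by split=> // i; rewrite sl2.
Qed.

End Path.

(** * The entry of the root *)

Lemma ancestor_leq a x : ancestor a x -> x <= a.
Proof. by case=> k ->; apply: leq_div. Qed.

Lemma ancestor1 a : 0 < a -> ancestor a 1.
Proof.
elim/ltn_ind: a => a IH a0; have [->|a1] := eqVneq a 1; first exact: ancestor_refl.
by apply: ancestorS; apply: IH; lia.
Qed.

Lemma ancestor_child a x : ancestor a x -> x < a -> ancestor a x.*2 \/ ancestor a x.*2.+1.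
Proof.
case=> [[|k]] ->; first by rewrite divn1 ltnn.
move=> _; set z := a %/ 2 ^ k; have hz : ancestor a z by exists k.
have -> : a %/ 2 ^ k.+1 = z %/ 2 by rewrite expnSr divnMA.
have [e|e] : z = (z %/ 2).*2 \/ z = (z %/ 2).*2.+1 by lia.
  by left; rewrite -e.
by right; rewrite -e.
Qed.

(** The address [2 * 2] is [pair_cell 1 1]. Clearing registers 4 to 19 leaves [rN] as the only
    register holding a word. *)
Definition report : command :=
  $ radr <- rtwo [*] rtwo ;; Do (Read 1 radr) ;;
  $ radr <- radr [+] rone ;; Do (Read 2 radr) ;;
  foldr (fun r p => Do (Clear r) ;; p) Skip (iota 4 16).

Definition rebuild : command :=
  refresh_path ;; Do (Move ra rq) ;; refresh_path ;; report.

Section Rebuild.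
Variables (T : eqType) (disp : Order.disp_t) (D : orderType disp).
Variable d : T -> T -> D.
Hypothesis dC : forall x y, d x y = d y x.
Implicit Types (c : nat -> value T D) (s : state T D) (A : seq T).

Record leaves n c A : Prop := Leaves {
  leaf_mem : forall i, n <= i < 2 * n -> exists2 x, x \in A & c (leaf_cell i) = Obj x;
  leaf_inj : forall i j, n <= i < 2 * n -> n <= j < 2 * n ->
    c (leaf_cell i) = c (leaf_cell j) -> i = j;
  leaf_sur : forall x, x \in A -> exists2 i, n <= i < 2 * n & c (leaf_cell i) = Obj x }.

(** The second case of [rep_size] covers the initial state, where every register is blank. *)
Record represents A s : Prop := Represents {
  rep_size : regs s rN = Word (size A) \/ A = [::] /\ regs s rN = Blank;
  rep_regs : forall r, r != rN -> no_word (regs s r);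
  rep_uniq : uniq A;
  rep_heap : heap_mem (size A) (cells s);
  rep_leaves : leaves (size A) (cells s) A;
  rep_consistent : consistent d (size A) (cells s) (fun _ _ => False) }.

Lemma closer_cases e e' : closer d e e' = e \/ closer d e e' = e'.
Proof.
case: e e' => [[|?|?|?] [|?|?|?]] [[|?|?|?] [|?|?|?]] /=; try (by left); try (by right).
by case: ifP; [left|right].
Qed.

Lemma closer_l p q e' : well_typed e' -> exists p' q',
  closer d (Obj p, Obj q) e' = (Obj p', Obj q') /\ (d p' q' <= d p q)%O.
Proof.
case=> [->|[p' [q' ->]]] /=; first by exists p, q; rewrite Order.POrderTheory.lexx.
case: ifP => h; first by exists p, q; rewrite Order.POrderTheory.lexx.
exists p', q'; split=> //; move/negbT: h; rewrite -Order.TotalTheory.ltNge.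
exact: Order.POrderTheory.ltW.
Qed.

Lemma closer_r p q e : well_typed e -> exists p' q',
  closer d e (Obj p, Obj q) = (Obj p', Obj q') /\ (d p' q' <= d p q)%O.
Proof.
case=> [->|[p' [q' ->]]] /=; first by exists p, q; rewrite Order.POrderTheory.lexx.
case: ifP => h; first by exists p', q'.
by exists p, q; rewrite Order.POrderTheory.lexx.
Qed.

Section Heap.
Variables (n : nat) (c : nat -> value T D) (A : seq T).
Hypotheses (hm : heap_mem n c) (hl : leaves n c A).
Hypothesis hc : consistent d n c (fun _ _ => False).

Definition near u v : bool :=
  [&& 0 < u < 2 * n, 0 < v < 2 * n, u <= v.*2.+1 & v <= u.*2.+1].

Lemma pair_at_value u v : near u v -> pair_at c u v = pair_value d n c u v.
Proof.
rewrite /near => h; case: (leqP v u) => uv; last rewrite pair_atC pair_valueC.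
  by apply: hc; [lia|lia|lia|case].
by apply: hc; [lia|lia|lia|case].
Qed.

(** Induction along the recurrence of the table; it terminates because splitting a node increases
    [u + v], which stays below [4 * n]. *)
Lemma near_ind (P : nat -> nat -> Prop) :
  (forall u v, P u v -> P v u) ->
  (forall u v, near u v -> n <= v <= u -> P u v) ->
  (forall u v, near u v -> v <= u -> v < n -> P v.*2 u -> P v.*2.+1 u -> P u v) ->
  forall u v, near u v -> P u v.
Proof.
move=> PC P1 P2 u v; have [k] := ubnP (4 * n - (u + v)).
elim: k u v => // k IH u v hk huv.
wlog vu : u v hk huv / v <= u.
  move=> h; case: (leqP v u) => vu; first exact: h.
  by apply: PC; apply: h; rewrite /near in huv *; lia.
case: (leqP n v) => nv; first by apply: P1 => //; lia.
by apply: P2 => //; apply: IH; rewrite /near in huv *; lia.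
Qed.

Lemma pair_at_mem u v p q : near u v -> pair_at c u v = (Obj p, Obj q) ->
  [/\ p \in A, q \in A & p != q].
Proof.
move=> h; move: u v h p q.
apply: near_ind => [u v h p q|u v huv nv p q|u v huv vu vn IH1 IH2 p q].
- by rewrite pair_atC => /h.
- rewrite pair_at_value // /pair_value.
  have -> : n <= minn u v by lia.
  case: eqP => // uv.
  have hmax : n <= maxn u v < 2 * n by rewrite /near in huv; lia.
  have hmin : n <= minn u v < 2 * n by rewrite /near in huv; lia.
  have [x xA ex] := leaf_mem hl hmax; have [y yA ey] := leaf_mem hl hmin.
  rewrite ex ey => -[<- <-]; split=> //; apply: contra_notN uv => /eqP xy.
  by have := leaf_inj hl hmax hmin; rewrite ex ey xy => /(_ erefl); lia.
- rewrite pair_at_value // /pair_value.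
  have [-> ->] : minn u v = v /\ maxn u v = u by lia.
  rewrite leqNgt vn.
  by case: (closer_cases (pair_at c v.*2 u) (pair_at c v.*2.+1 u)) => -> ; [apply: IH1|apply: IH2].
Qed.

(** A leaf below the split node lies below one of its children, whose entry is good enough by
    induction, and [closer] is at least as good as both its arguments. Symmetry of [d] enters
    because the order within an entry does not tell which object lies below which node. *)
Lemma pair_at_min u v x y p q : near u v -> ancestor x u -> ancestor y v ->
  n <= x < 2 * n -> n <= y < 2 * n -> x <> y ->
  c (leaf_cell x) = Obj p -> c (leaf_cell y) = Obj q ->
  exists p' q', pair_at c u v = (Obj p', Obj q') /\ (d p' q' <= d p q)%O.
Proof.
move=> h; move: u v h x y p q.
apply: near_ind => [u v h x y p q xu yv hx hy xy ex ey|u v huv nv|u v huv vu vn IH1 IH2].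
- by rewrite pair_atC dC; apply: (h y x) => // /esym.
- move=> x y p q xu yv hx hy xy ex ey.
  (* A proper ancestor of a leaf is at most half of it, hence below [n]. *)
  have leaf z w : ancestor z w -> n <= w -> z < 2 * n -> w = z.
    by move=> /ancestorE[//|/ancestor_leq]; lia.
  have ux : u = x by apply: leaf => //; lia.
  have vy : v = y by apply: leaf => //; lia.
  rewrite pair_at_value // /pair_value ux vy.
  have -> : n <= minn x y by lia.
  move: xy => /eqP/negPf ->; case: (leqP x y) => xy; rewrite ?ex ?ey.
    by exists q, p; rewrite dC.
  by exists p, q.
- move=> x y p q xu yv hx hy xy ex ey.
  rewrite pair_at_value // /pair_value.
  have [-> ->] : minn u v = v /\ maxn u v = u by lia.
  rewrite leqNgt vn dC.
  have yx : y <> x by move=> /esym.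
  have [yv'|yv'] : ancestor y v.*2 \/ ancestor y v.*2.+1.
      by apply: ancestor_child => //; lia.
    have [p' [q' [-> h1]]] := IH1 _ _ _ _ yv' xu hy hx yx ey ex.
    have [|p2 [q2 [-> h2]]] := @closer_l p' q' (pair_at c v.*2.+1 u).
      by apply: (heap_pair hm); rewrite /near in huv; lia.
    by exists p2, q2; split=> //; apply: Order.POrderTheory.le_trans h1.
  have [p' [q' [-> h1]]] := IH2 _ _ _ _ yv' xu hy hx yx ey ex.
  have [|p2 [q2 [-> h2]]] := @closer_r p' q' (pair_at c v.*2 u).
    by apply: (heap_pair hm); rewrite /near in huv; lia.
  by exists p2, q2; split=> //; apply: Order.POrderTheory.le_trans h1.
Qed.

Lemma root_closest_pair : 1 < n ->
  exists x y, pair_at c 1 1 = (Obj x, Obj y) /\ closest_pair d A x y.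
Proof.
move=> n1; have h11 : near 1 1 by rewrite /near; lia.
have hlow p q : p \in A -> q \in A -> p != q -> exists p' q',
    pair_at c 1 1 = (Obj p', Obj q') /\ (d p' q' <= d p q)%O.
  move=> /(leaf_sur hl)[i hi ei] /(leaf_sur hl)[j hj ej] pq.
  have ij : i <> j by move=> ij; move: ei; rewrite ij ej => -[qp]; rewrite qp eqxx in pq.
  by apply: pair_at_min ei ej => //; apply: ancestor1; lia.
(* As [1 < n], the leaves [n] and [n.+1] hold two distinct objects, so the entry of the root is not
   blank. *)
have hn : n <= n < 2 * n by lia.
have hn1 : n <= n.+1 < 2 * n by lia.
have [p pA ep] := leaf_mem hl hn; have [q qA eq] := leaf_mem hl hn1.
have pq : p != q.
  apply/eqP => pq; have := leaf_inj hl hn hn1; rewrite ep eq pq => /(_ erefl); lia.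
have [x [y [exy _]]] := hlow p q pA qA pq.
exists x, y; split=> //; have [xA yA xy] := pair_at_mem h11 exy.
split=> // p' q' pA' qA' pq'; have [x' [y' []]] := hlow p' q' pA' qA' pq'.
by rewrite exy => -[-> ->].
Qed.

End Heap.

Lemma leaves_eq n c c' A : same_leaves c c' -> leaves n c A -> leaves n c' A.
Proof.
move=> e [h1 h2 h3]; split.
- by move=> i; rewrite e; apply: h1.
- by move=> i j; rewrite !e; apply: h2.
- by move=> x /h3[i hi ei]; exists i; rewrite ?e.
Qed.

Variables space word N : nat.
Hypothesis hspace : 8 * N ^ 2 <= space.
Hypothesis hword : 100 * N.+1 ^ 2 <= word.

Lemma vc_report A s : let n := size A in
  constants n s -> (forall r, (r < 3) || (19 < r) -> no_word (regs s r)) ->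
  heap_mem n (cells s) -> leaves n (cells s) A -> uniq A ->
  consistent d n (cells s) (fun _ _ => False) ->
  vc d space word report s (fun s' =>
    represents A s' /\ (1 < n -> reports_closest_pair d A s')).
Proof.
move=> n [c1 c2 c3] hr hm hl uA hc.
do ?[progress rewrite /= ?c1 ?c2 ?c3].
do 2![split; first by nia].
split.
  split=> //=; first by left.
  move=> r; do 20?[case: r => [|r] //=]; rewrite ?(heap_no_word hm) //;
    by move=> _; apply: hr.
move=> n1; have [x [y [[e1 e2] h]]] := root_closest_pair hm hl hc n1.
by exists x, y.
Qed.

Lemma wp_rebuild A p q s : let n := size A in n <= N ->
  p <= (2 * n).-1 -> q <= (2 * n).-1 ->
  fits space word s -> constants n s -> regs s ra = Word p -> regs s rq = Word q ->
  (forall r, (r < 3) || (19 < r) -> no_word (regs s r)) ->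
  heap_mem n (cells s) -> leaves n (cells s) A -> uniq A ->
  consistent d n (cells s)
    (fun u v => [\/ ancestor q u, ancestor q v, ancestor p u | ancestor p v]) ->
  wp d space word rebuild s (400 * (p + q) + 40)
    (fun s' => represents A s' /\ (1 < n -> reports_closest_pair d A s')).
Proof.
move=> n hn hp hq fs cs rga rgq hr hm hl uA hc; have [c1 c2 c3] := cs.
(* The summands pay for the first path, the move, the second path and [report]. *)
rewrite (_ : _ + 40 = (400 * p).+1 + (1 + ((400 * q).+1 + 37))); last by lia.
apply: wp_seq.
apply: wp_weaken (wp_frame (wp_refresh_path hspace hword hn hp fs cs rga hm hc))
  (leqnn _) _ => s1 [[fs1 hm1 sl1 hc1] fr1].
apply: wp_seq.
have rq1 : regs s1 rq = Word q by rewrite fr1.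
have {}cs : constants n s1 by split; rewrite fr1.
apply: wp_weaken (@wp_vc _ _ _ _ _ _ (Do (Move ra rq)) s1 (fun s2 => s2 = set_reg s1 ra (Word q)) fs1 _) (leqnn _) _.
  by rewrite /= rq1.
move=> s2 [fs2 es2]; rewrite {s2}es2 in fs2 *; apply: wp_seq.
have hc2 : consistent d n (cells s1)
    (fun u v => [\/ False, False, ancestor q u | ancestor q v]).
  by move=> u v v0 uv un ns; apply: hc1 => // h; apply: ns; case: h; [apply: Or43|apply: Or44].
apply: wp_weaken (wp_frame (@wp_refresh_path _ _ _ d _ _ _ hspace hword (fun _ => False) n q
  (set_reg s1 ra (Word q)) hn hq fs2 _ _ hm1 hc2)) (leqnn _) _ => //.
move=> s3 [[fs3 hm3 sl3 hc3] fr3].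
have run : vc d space word report s3 (fun s' =>
    represents A s' /\ (1 < n -> reports_closest_pair d A s')).
  apply: vc_report => //.
  - by case: cs => *; split; rewrite fr3.
  - move=> r hr'.
    have hw : ~~ writes refresh_path r by move: hr'; do 20?[case: r => [|r] //].
    have hra : (r == ra) = false by lia.
    by rewrite fr3 //= hra fr1 //; apply: hr.
  - by apply: leaves_eq sl3 _; apply: leaves_eq sl1 _.
  - by move=> u v v0 uv un _; apply: hc3 => //; case.
by apply: wp_weaken (wp_vc fs3 run) _ _ => // s' [].
Qed.

End Rebuild.

(** * Insertion and deletion *)

Definition set_constants : command :=
  If (IsBlank rN) (Do (Const rN 0)) Skip ;; Do (Const rone 1) ;; Do (Const rtwo 2).

(** For [n = 0] cell 0 is copied to itself, and the new object becomes leaf 1, the only leaf. *)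
Definition split_leaf : command :=
  $ radr <- rN [*] rN ;; $ radr <- radr [*] rtwo ;; Do (Read rX radr) ;;
  $ rq <- rN [*] rtwo ;; $ radr <- rq [*] rq ;; $ radr <- radr [*] rtwo ;;
  Do (Write radr rX) ;;
  $ ra <- rq [+] rone ;; $ radr <- ra [*] ra ;; $ radr <- radr [*] rtwo ;;
  Do (Write radr 0) ;; $ rN <- rN [+] rone.

Definition insertion : command := set_constants ;; split_leaf ;; rebuild.

Definition find_leaf : command :=
  $ rw <- rN [*] rtwo ;; $ rw <- rw [-] rone ;;
  While (WordLe rN rw)
    ($ radr <- rw [*] rw ;; $ radr <- radr [*] rtwo ;; Do (Read rX radr) ;;
     If (SameObject rX 0) (Do (Move ra rw)) Skip ;; $ rw <- rw [-] rone).

(** Leaf [2 * n - 2] is copied to [n - 1] only after the freed leaf has been refilled, since the two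
    may coincide. *)
Definition merge_leaves : command :=
  $ rt <- rN [*] rtwo ;; $ rt <- rt [-] rone ;;
  $ radr <- rt [*] rt ;; $ radr <- radr [*] rtwo ;; Do (Read rX radr) ;;
  $ radr <- ra [*] ra ;; $ radr <- radr [*] rtwo ;; Do (Write radr rX) ;;
  $ rt <- rt [-] rone ;;
  $ radr <- rt [*] rt ;; $ radr <- radr [*] rtwo ;; Do (Read rX radr) ;;
  $ rq <- rN [-] rone ;;
  $ radr <- rq [*] rq ;; $ radr <- radr [*] rtwo ;; Do (Write radr rX).

Definition release_range : command :=
  $ rt <- rtwo [*] rtwo ;; $ rt <- rt [*] rtwo ;;
  $ rw <- rq [*] rq ;; $ rw <- rw [*] rt ;;
  $ rlo <- rN [*] rN ;; $ rlo <- rlo [*] rt ;; $ rlo <- rlo [-] rone ;;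
  Do (Clear rX).

Definition release_cells : command :=
  release_range ;;
  While (WordLe rw rlo) (Do (Write rw rX) ;; $ rw <- rw [+] rone).

(** If the refilled leaf is one of the two that disappear, its parent, the new leaf, takes its place
    as start of the path. *)
Definition drop_leaf : command :=
  Do (Move rN rq) ;; $ rt <- rN [*] rtwo ;;
  If (WordLe rt ra) ($ ra <- ra [/] rtwo) Skip.

Definition deletion : command :=
  set_constants ;; find_leaf ;; merge_leaves ;; release_cells ;; drop_leaf ;; rebuild.

Lemma leaf_cell_eq i j : (leaf_cell i == leaf_cell j) = (i == j).
Proof.
by apply/eqP/eqP => [|->] //; rewrite !leaf_cellE => /pair_cell_inj; lia.
Qed.

Lemma pair_leaf_eq u v i : 0 < u -> 0 < v ->
  (pair_cell u v == leaf_cell i) = false /\ ((pair_cell u v).+1 == leaf_cell i) = false.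
Proof.
move=> u0 v0; rewrite leaf_cellE; split; apply/eqP; first by move=> /pair_cell_inj; lia.
by move=> /esym; apply: pair_cell_neqS.
Qed.

Lemma leaf_cell_bound i n : i < 2 * n -> leaf_cell i < 8 * n ^ 2.
Proof. by move=> h; rewrite /leaf_cell; have := leq_mul h h; nia. Qed.

Lemma pair_cell_bound u v n : u < 2 * n -> v < 2 * n -> (pair_cell u v).+1 < 8 * n ^ 2.
Proof.
move=> hu hv; have hM : maxn u v < 2 * n by lia.
have : minn u v <= maxn u v by lia.
by rewrite /pair_cell; have := leq_mul hM hM; nia.
Qed.

Section Updates.
Variables (T : eqType) (disp : Order.disp_t) (D : orderType disp).
Variable d : T -> T -> D.
Implicit Types (c : nat -> value T D) (s : state T D) (A : seq T).

(** * The heap after splitting leaf [n] *)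

Section Insert.
Variables (n : nat) (c c' : nat -> value T D) (x : T).
Hypothesis hc' : forall e, c' e =
  if e == leaf_cell (2 * n).+1 then Obj x
  else if e == leaf_cell (2 * n) then c (leaf_cell n) else c e.

Let pair_same u v : 0 < u -> 0 < v -> pair_at c' u v = pair_at c u v.
Proof.
move=> u0 v0; rewrite /pair_at !hc'.
by rewrite !(pair_leaf_eq _ u0 v0).1 !(pair_leaf_eq _ u0 v0).2.
Qed.

Let leafE i : c' (leaf_cell i) = if i == (2 * n).+1 then Obj x
  else if i == 2 * n then c (leaf_cell n) else c (leaf_cell i).
Proof. by rewrite hc' !leaf_cell_eq. Qed.

(* In the new heap, position [2 * n] is the former leaf [n]. *)
Let old i : nat := if i == 2 * n then n else i.

Let old_leaf i : n.+1 <= i < 2 * n.+1 -> i <> (2 * n).+1 ->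
  n <= old i < 2 * n /\ c' (leaf_cell i) = c (leaf_cell (old i)).
Proof.
move=> hi /eqP/negPf ne; rewrite leafE ne /old.
by case: (eqVneq i (2 * n)) => h; (split; [lia|by []]).
Qed.

Lemma heap_mem_insert : heap_mem n c -> heap_mem n.+1 c'.
Proof.
case=> hp hl1 hw hb; split.
- by move=> u v u0 v0; rewrite pair_same //; apply: hp.
- move=> i hi; have [->|/eqP ne] := eqVneq i (2 * n).+1.
    by rewrite leafE eqxx; exists x.
  by have [h ->] := old_leaf hi ne; apply: hl1.
- by move=> e; rewrite hc'; do 2?case: ifP.
- move=> e he; rewrite hc' (hb e); last by apply: leq_trans he; rewrite -!mulnn; nia.
  have h1 : leaf_cell (2 * n).+1 < 8 * n.+1 ^ 2 by apply: leaf_cell_bound; lia.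
  have h2 : leaf_cell (2 * n) < 8 * n.+1 ^ 2 by apply: leaf_cell_bound; lia.
  by have [-> ->] : e == leaf_cell (2 * n).+1 = false /\ e == leaf_cell (2 * n) = false by lia.
Qed.

Lemma leaves_insert A : x \notin A -> leaves n c A -> leaves n.+1 c' (x :: A).
Proof.
move=> xA [h1 h2 h3].
have hx i : n.+1 <= i < 2 * n.+1 -> i <> (2 * n).+1 -> c' (leaf_cell i) <> Obj x.
  move=> hi ne; have [h ->] := old_leaf hi ne; have [y yA ->] := h1 _ h.
  by move=> -[yx]; rewrite yx (negPf xA) in yA.
have hx' : c' (leaf_cell (2 * n).+1) = Obj x by rewrite leafE eqxx.
split.
- move=> i hi; have [->|/eqP ne] := eqVneq i (2 * n).+1.
    by exists x; rewrite ?mem_head.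
  have [h ->] := old_leaf hi ne; have [y yA ->] := h1 _ h.
  by exists y => //; rewrite inE yA orbT.
- move=> i j hi hj; have [->|/eqP ni] := eqVneq i (2 * n).+1;
    have [->|/eqP nj] := eqVneq j (2 * n).+1 => //.
  + by rewrite hx' => /esym /hx; case.
  + by rewrite hx' => /hx; case.
  + have [h ->] := old_leaf hi ni; have [h' ->] := old_leaf hj nj => /(h2 _ _ h h').
    by rewrite /old; do 2!case: eqP => ?; lia.
- move=> y; rewrite inE => /orP[/eqP ->|/h3[i hi ei]].
    by exists (2 * n).+1 => //; lia.
  have [in_|ne] := eqVneq i n.
    exists (2 * n); first by lia.
    by rewrite leafE eqxx -in_ ei; case: eqP => //; lia.
  exists i; first by lia.
  by rewrite leafE; case: eqP => [|_]; [lia|case: eqP => [|_ //]; lia].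
Qed.

(** No entry is moved. A prescribed value can change only for entries involving a new leaf or the
    former leaf [n], which is the parent of both new leaves; all of these lie on the two paths. *)
Lemma consistent_insert : consistent d n c (fun _ _ => False) -> consistent d n.+1 c' (fun u v =>
  [\/ ancestor (2 * n) u, ancestor (2 * n) v,
      ancestor (2 * n).+1 u | ancestor (2 * n).+1 v]).
Proof.
move=> hc u v v0 uv un ns.
have u1 : u <> 2 * n by move=> e; apply: ns; apply: Or41; rewrite e; apply: ancestor_refl.
have u2 : u <> (2 * n).+1.
  by move=> e; apply: ns; apply: Or43; rewrite e; apply: ancestor_refl.
have hn : ancestor (2 * n) n by exists 1; lia.
have v1 : v <> n by move=> e; apply: ns; apply: Or42; rewrite e.
rewrite pair_same; [|lia|lia].
rewrite hc //; last by lia.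
rewrite /pair_value; have [-> ->] : minn u v = v /\ maxn u v = u by lia.
rewrite (_ : (n < v) = (n <= v)); last by lia.
case: leqP => nv; last by rewrite !pair_same //; lia.
have same i : n < i < 2 * n -> c' (leaf_cell i) = c (leaf_cell i).
  by move=> hi; rewrite leafE !ifF //; apply/eqP; lia.
by rewrite !same //; lia.
Qed.

End Insert.

(** * The heap after moving the last leaf, merging two leaves and releasing cells *)

Section Delete.
Variables (n p : nat) (c c' : nat -> value T D).
Hypothesis hp : n <= p < 2 * n.
Let c1 e := if e == leaf_cell p then c (leaf_cell (2 * n).-1) else c e.
Hypothesis hc' : forall e, c' e =
  if 8 * n.-1 ^ 2 <= e then Blank
  else if e == leaf_cell n.-1 then c1 (leaf_cell (2 * n).-2) else c1 e.

Let n0 : 0 < n. Proof. lia. Qed.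

Let pair_same u v : 0 < u < 2 * n.-1 -> 0 < v < 2 * n.-1 -> pair_at c' u v = pair_at c u v.
Proof.
move=> hu hv; have /andP[u0 un] := hu; have /andP[v0 vn] := hv.
have hb := pair_cell_bound un vn.
rewrite /pair_at !hc' /c1.
rewrite !(pair_leaf_eq _ u0 v0).1 !(pair_leaf_eq _ u0 v0).2.
by rewrite !ifF //; lia.
Qed.

(* The leaf of the old heap whose object leaf [i] of the new heap holds. *)
Let old i : nat :=
  let j := if i == n.-1 then (2 * n).-2 else i in
  if j == p then (2 * n).-1 else j.

Let leafE i : i < 2 * n.-1 -> c' (leaf_cell i) = c (leaf_cell (old i)).
Proof.
move=> hi; have hb := leaf_cell_bound hi.
rewrite hc' ifF; last by lia.
rewrite leaf_cell_eq /old; case: ifP => h; rewrite /c1 leaf_cell_eq; by case: ifP.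
Qed.

Let old_range i : n.-1 <= i < 2 * n.-1 -> n <= old i < 2 * n.
Proof. by rewrite /old => hi; case: (eqVneq i n.-1) => ?; case: ifP => ?; lia. Qed.

Let old_neq i : n.-1 <= i < 2 * n.-1 -> old i <> p.
Proof. by rewrite /old => hi; case: (eqVneq i n.-1) => ?; case: ifP => ?; lia. Qed.

Let old_inj i j : n.-1 <= i < 2 * n.-1 -> n.-1 <= j < 2 * n.-1 -> old i = old j -> i = j.
Proof.
by rewrite /old => hi hj; case: (eqVneq i n.-1) => ?; case: (eqVneq j n.-1) => ?;
  do ?case: ifP => ?; lia.
Qed.

Let old_sur j : n <= j < 2 * n -> j <> p -> exists2 i, n.-1 <= i < 2 * n.-1 & old i = j.
Proof.
move=> hj jp.
(* This inverts [old]: the last leaf went to [p], and on to [n.-1] if [p] is the last but one; the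
   last but one went to [n.-1]. *)
exists (if j == (2 * n).-1 then if p == (2 * n).-2 then n.-1 else p
        else if j == (2 * n).-2 then n.-1 else j).
  by do ?case: ifP => ?; lia.
have [pn jn] : (p == n.-1) = false /\ (j == n.-1) = false by lia.
rewrite /old; case: (eqVneq j (2 * n).-1) => ?.
  by case: (eqVneq p (2 * n).-2) => ?; rewrite ?eqxx ?pn ?jn; do ?case: ifP => ?; lia.
by case: (eqVneq j (2 * n).-2) => ?; rewrite ?eqxx ?pn ?jn; do ?case: ifP => ?; lia.
Qed.

Lemma heap_mem_delete : heap_mem n c -> heap_mem n.-1 c'.
Proof.
case=> hp1 hl1 hw hb; split.
(* The threshold and [pair_cell u v] are even, so the two cells of an entry are released together or
   not at all. *)
- move=> u v u0 v0; case: (leqP (8 * n.-1 ^ 2) (pair_cell u v).+1) => h.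
    left; rewrite /pair_at !hc' h ifT //.
    move: h; rewrite /pair_cell -mulnn; lia.
  have [f1 f2] : (8 * n.-1 ^ 2 <= pair_cell u v) = false /\
      (8 * n.-1 ^ 2 <= (pair_cell u v).+1) = false by lia.
  rewrite /pair_at !hc' /c1 f1 f2 !(pair_leaf_eq _ u0 v0).1 !(pair_leaf_eq _ u0 v0).2.
  exact: hp1.
- by move=> i hi; rewrite leafE; [apply: hl1; apply: old_range|lia].
- by move=> e; rewrite hc' /c1; do 3?case: ifP.
- by move=> e he; rewrite hc' he.
Qed.

Lemma leaves_delete A x : uniq A -> c (leaf_cell p) = Obj x ->
  leaves n c A -> leaves n.-1 c' (rem x A).
Proof.
move=> uA hx [h1 h2 h3]; split.
- move=> i hi; have ho := old_range hi; have [y yA ey] := h1 _ ho.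
  exists y; last by rewrite leafE //; lia.
  rewrite mem_rem_uniq // inE yA andbT; apply/eqP => yx.
  by apply: (old_neq hi); apply: h2; rewrite // ey yx hx.
- move=> i j hi hj; rewrite !leafE; [|lia|lia].
  by move=> /(h2 _ _ (old_range hi) (old_range hj)) /old_inj; apply.
- move=> y; rewrite mem_rem_uniq // inE => /andP[yx /h3[j hj ej]].
  have [|i hi ei] := @old_sur j hj.
    by move=> jp; move: ej; rewrite jp hx => -[xy]; rewrite xy eqxx in yx.
  by exists i => //; rewrite leafE ?ei //; lia.
Qed.

(** Only two surviving leaves differ from before: [n.-1], formerly internal, and [p'], the place
    that now accounts for the refilled leaf [p]. Entries of other nodes keep their prescribed
    values. *)
Lemma consistent_delete :
  let p' := if 2 * n.-1 <= p then p %/ 2 else p in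
  consistent d n c (fun _ _ => False) -> consistent d n.-1 c' (fun u v =>
    [\/ ancestor n.-1 u, ancestor n.-1 v, ancestor p' u | ancestor p' v]).
Proof.
move=> p' hc u v v0 uv un ns.
have u1 : u <> n.-1 by move=> e; apply: ns; apply: Or41; rewrite e; apply: ancestor_refl.
have v1 : v <> n.-1 by move=> e; apply: ns; apply: Or42; rewrite e; apply: ancestor_refl.
have u2 : u <> p'.
  by move=> e; apply: ns; apply: Or43; rewrite e; apply: ancestor_refl.
have v2 : v <> p'.
  by move=> e; apply: ns; apply: Or44; rewrite e; apply: ancestor_refl.
rewrite pair_same; [|lia|lia].
rewrite hc //; last by lia.
rewrite /pair_value; have [-> ->] : minn u v = v /\ maxn u v = u by lia.
rewrite (_ : (n.-1 <= v) = (n <= v)); last by lia.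
case: leqP => nv; last by rewrite !pair_same //; lia.
have same i : i <> n.-1 -> i <> p' -> i < 2 * n.-1 -> c' (leaf_cell i) = c (leaf_cell i).
  move=> i1 i2 i3; rewrite leafE //; congr (c (leaf_cell _)).
  rewrite /old (negPf (introN eqP i1)) ifF //; apply/eqP => ip.
  by apply: i2; rewrite /p' -ip ifF //; lia.
by rewrite !same //; lia.
Qed.

End Delete.

End Updates.

(** * Correctness and running time of the two updates *)

Section Programs.
Variables (T : eqType) (disp : Order.disp_t) (D : orderType disp).
Variable d : T -> T -> D.
Hypothesis dC : forall x y, d x y = d y x.
Implicit Types (c : nat -> value T D) (s : state T D) (A : seq T).

Variables space word N : nat.
Hypothesis hspace : 8 * N ^ 2 <= space.
Hypothesis hword : 100 * N.+1 ^ 2 <= word.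

Lemma wp_set_constants A u s : represents d A s -> size A <= N ->
  fits space word (call u s) ->
  wp d space word set_constants (call u s) 4 (fun s' =>
    [/\ fits space word s', constants (size A) s' & cells s' = cells s]).
Proof.
move=> hr hN fs.
have run : vc d space word set_constants (call u s) (fun s' =>
    constants (size A) s' /\ cells s' = cells s).
  case: (rep_size hr) => [e|[eA e]]; rewrite /= e.
    by do 2?[split; first by nia].
  by do 3?[split; first by nia]; split; rewrite // eA.
by apply: wp_weaken (wp_vc fs run) _ _ => // s' [? []].
Qed.

Lemma vc_split_leaf n x s : n < N -> constants n s -> regs s 0 = Obj x ->
  vc d space word split_leaf s (fun s' =>
    [/\ constants n.+1 s', regs s' ra = Word (2 * n).+1, regs s' rq = Word (2 * n) &
      forall e, cells s' e = if e == leaf_cell (2 * n).+1 then Obj x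
        else if e == leaf_cell (2 * n) then cells s (leaf_cell n) else cells s e]).
Proof.
move=> hn [c1 c2 c3] r0.
have e1 : n * 2 = 2 * n by lia.
do ?[progress rewrite /= ?c1 ?c2 ?c3 ?r0 ?e1 ?addn1].
have b1 : n * n <= N * N by nia.
do 11![split; first by nia].
split=> //.
Qed.

Lemma wp_insertion A x s : represents d A s -> size A < N -> x \notin A ->
  fits space word (call (Insert x) s) ->
  wp d space word insertion (call (Insert x) s) (2000 * (size A).+1) (fun s' =>
    represents d (x :: A) s' /\
    (1 < (size A).+1 -> reports_closest_pair d (x :: A) s')).
Proof.
move=> hr hn xA fs; set n := size A in hn *.
(* The costs of [set_constants], [split_leaf] and [rebuild] on the leaves [2 * n + 1] and [2 * n];
   their sum is [1600 * n + 456]. *)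
apply: wp_weaken (_ : wp d space word insertion (call (Insert x) s)
  (4 + (12 + (400 * ((2 * n).+1 + 2 * n) + 40))) _) _ _; last first.
- by move=> s'; exact.
- by lia.
apply: wp_seq.
apply: wp_weaken (wp_frame (wp_set_constants hr (ltnW hn) fs)) (leqnn _) _.
move=> s1 [[fs1 cs1 ec1] fr1]; apply: wp_seq.
have r0 : regs s1 0 = Obj x by rewrite fr1.
apply: wp_weaken (wp_frame (wp_vc fs1 (vc_split_leaf hn cs1 r0))) _ _ => //.
move=> s2 [[fs2 [cs2 rga rgq ec2]] fr2]; rewrite ec1 in ec2.
have [hm hl hc] := And3 (rep_heap hr) (rep_leaves hr) (rep_consistent hr);
  rewrite -/n in hm hl hc.
have hreb := @wp_rebuild _ _ _ d dC _ _ _ hspace hword (x :: A) (2 * n).+1 (2 * n) s2.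
rewrite [size _]/= -/n in hreb; apply: hreb => //.
- by lia.
- by lia.
- move=> r hr'; have [w1 w2] : ~~ writes split_leaf r /\ ~~ writes set_constants r.
    by move: hr'; do 20?[case: r => [|r] //].
  rewrite fr2 // fr1 //=; case: ifP => // _.
  by apply: (rep_regs hr); apply/eqP => h; rewrite h in hr'.
- exact: heap_mem_insert ec2 hm.
- exact (leaves_insert ec2 xA hl).
- by rewrite /= xA (rep_uniq hr).
- exact: consistent_insert ec2 hc.
Qed.

Lemma wp_find_leaf n A x s : n <= N -> leaves n (cells s) A -> x \in A ->
  fits space word s -> constants n s -> regs s 0 = Obj x ->
  wp d space word find_leaf s (7 * n + 3) (fun s' =>
    [/\ fits space word s', cells s' = cells s &
      exists p, [/\ regs s' ra = Word p, n <= p < 2 * n & cells s (leaf_cell p) = Obj x]]).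
Proof.
move=> hn hl xA fs [c1 c2 c3] r0.
have [i hi ei] := leaf_sur hl xA.
set body := ($ radr <- rw [*] rw ;; $ radr <- radr [*] rtwo ;; Do (Read rX radr) ;;
     If (SameObject rX 0) (Do (Move ra rw)) Skip ;; $ rw <- rw [-] rone).
pose found s' := exists p,
  [/\ regs s' ra = Word p, n <= p < 2 * n & cells s (leaf_cell p) = Obj x].
(* A pass costs 7 with its test. Until [x] is found, its leaf [i] is still ahead of the downward
   scan. *)
pose I m s' := exists w, [/\ n.-1 <= w < 2 * n, m = (7 * (w.+1 - n)).+1,
  [/\ fits space word s', constants n s', regs s' 0 = Obj x & regs s' rw = Word w],
  cells s' = cells s & found s' \/ i <= w].
rewrite (_ : 7 * n + 3 = 1 + (1 + (7 * n).+1)); last by lia.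
have run1 : vc d space word ($ rw <- rN [*] rtwo) s
  (fun s' => s' = set_reg s rw (Word (n * 2))).
  by rewrite /= c1 c3; split; first by nia.
apply: wp_seq; apply: wp_weaken (wp_vc fs run1) (leqnn _) _.
move=> s1 [fs1 es1]; rewrite {s1}es1 in fs1 *.
have run2 : vc d space word ($ rw <- rw [-] rone) (set_reg s rw (Word (n * 2)))
  (fun s' => [/\ constants n s', regs s' 0 = Obj x, regs s' rw = Word (n * 2 - 1) & cells s' = cells s]).
  by rewrite /= c2; split; first by nia.
apply: wp_seq; apply: wp_weaken (wp_vc fs1 run2) (leqnn _) _.
move=> s2 [fs2 [cs2 r02 rgw2 ec2]].
apply: (@wp_while _ _ _ d space word _ _ I) => [m s3|]; last first.
  by exists (n * 2 - 1); split=> //; [lia|lia|right; lia].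
case=> w [hw -> [fs3 cs3 r03 rgw3] ec3 hf].
have [d1 d2 d3] := cs3.
exists (n <= w); first by rewrite /= d1 rgw3.
case: (leqP n w) => nw; last first.
  by split=> //; split=> //; case: hf => // iw; exfalso; lia.
exists (cost body).
have hw' : n <= w < 2 * n by lia.
have [y yA ey] := leaf_mem hl hw'.
have run3 : vc d space word body s3 (fun s' =>
  [/\ constants n s', regs s' 0 = Obj x, regs s' rw = Word w.-1, cells s' = cells s &
    found s' \/ i <= w.-1]).
  rewrite /leaf_cell in ey.
  do ?[progress rewrite /= ?d1 ?d2 ?d3 ?r03 ?rgw3 ?ec3 ?ey].
  do 2?[split; first by nia].
  case: eqP => yx; split; rewrite ?subn1; try nia; split=> //.
    by left; exists w; rewrite /= ?ey ?yx.
  case: hf => [[p hp]|iw]; first by left; exists p.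
  have [iw'|] := eqVneq i w; last by right; lia.
  by move: ei; rewrite iw' /leaf_cell ey => -[].
apply: wp_weaken (wp_vc fs3 run3) (leqnn _) _ => s4 [fs4 [cs4 r04 rgw4 ec4 hf4]].
exists (7 * (w.-1.+1 - n)).+1; last by rewrite [cost _]/=; lia.
by exists w.-1; split=> //; lia.
Qed.

Lemma vc_merge_leaves n p s : 0 < n <= N -> n <= p < 2 * n ->
  constants n s -> regs s ra = Word p ->
  vc d space word merge_leaves s (fun s' =>
    regs s' rq = Word n.-1 /\
    let c1 e := if e == leaf_cell p then cells s (leaf_cell (2 * n).-1) else cells s e in
    forall e, cells s' e =
      if e == leaf_cell n.-1 then c1 (leaf_cell (2 * n).-2) else c1 e).
Proof.
move=> hn hp [c1 c2 c3] rga.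
have e1 : n * 2 - 1 = (2 * n).-1 by lia.
have e2 : (2 * n).-1 - 1 = (2 * n).-2 by lia.
do ?[progress rewrite /= ?c1 ?c2 ?c3 ?rga ?e1 ?e2 ?[n - 1]subn1].
have b1 : n * n <= N * N by nia.
have b2 : (2 * n).-1 * (2 * n).-1 <= (2 * n) * (2 * n) by nia.
have b3 : (2 * n).-2 * (2 * n).-2 <= (2 * n) * (2 * n) by nia.
have b4 : p * p < (2 * n) * (2 * n) by nia.
have b5 : n.-1 * n.-1 < n * n by nia.
by do 14?[split; first by nia].
Qed.

(** The bound [8 * n ^ 2] shrinks by fewer than [16 * n] cells, and each takes a test, a write and
    an increment. *)
Lemma wp_release_cells n s : 0 < n <= N -> constants n s -> regs s rq = Word n.-1 ->
  fits space word s ->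
  wp d space word release_cells s (48 * n + 9) (fun s' =>
    fits space word s' /\ forall e, cells s' e =
      if 8 * n.-1 ^ 2 <= e < 8 * n ^ 2 then Blank else cells s e).
Proof.
move=> hn [c1 c2 c3] rgq fs.
set c := cells s; set lo := 8 * n.-1 ^ 2; set hi := 8 * n ^ 2.
have [b1 b2] : lo < hi /\ hi <= 8 * N ^ 2 by rewrite /lo /hi -!mulnn; nia.
have b3 : n * n <= N * N by nia.
have b4 : n.-1 * n.-1 < n * n by nia.
have b5 : hi - lo < 16 * n by rewrite /lo /hi -!mulnn; nia.
have e1 : n.-1 * n.-1 * 8 = lo by rewrite /lo -mulnn; lia.
have e2 : n * n * 8 - 1 = hi.-1 by rewrite /hi -mulnn; lia.
have run : vc d space word release_range s (fun s' =>
    [/\ constants n s', regs s' rw = Word lo, regs s' rlo = Word hi.-1,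
      regs s' rX = Blank & cells s' = c]).
  do ?[progress rewrite /= ?c1 ?c2 ?c3 ?rgq].
  by do 7?[split; first by nia]; rewrite e1 e2.
pose I m s' := exists e, [/\ lo <= e <= hi, m = (3 * (hi - e)).+1,
  [/\ fits space word s', constants n s', regs s' rw = Word e,
    regs s' rlo = Word hi.-1 & regs s' rX = Blank] &
  forall a, cells s' a = if lo <= a < e then Blank else c a].
apply: wp_weaken (_ : wp d space word release_cells s (8 + (3 * (hi - lo)).+1) _) _ _;
  last first.
- by move=> s'; exact.
- by lia.
apply: wp_seq; apply: wp_weaken (wp_vc fs run) (leqnn _) _.
move=> s1 [fs1 [cs1 rgw1 rlo1 rX1 ec1]].
apply: (@wp_while _ _ _ d space word _ _ I) => [m s2|]; last first.
  exists lo; split=> //; first by lia.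
  by move=> a; rewrite ec1; case: ifP => //; lia.
case=> e [he -> [fs2 cs2 rgw2 rlo2 rX2] ec2]; have [d1 d2 d3] := cs2.
exists (e <= hi.-1); first by rewrite /= rgw2 rlo2.
case: (leqP e hi.-1) => he'; last first.
  split=> //; split=> // a; rewrite ec2.
  by have -> : e = hi by lia.
exists 2.
have run2 : vc d space word (Do (Write rw rX) ;; $ rw <- rw [+] rone) s2 (fun s' =>
    [/\ constants n s', regs s' rw = Word e.+1, regs s' rlo = Word hi.-1,
      regs s' rX = Blank & forall a, cells s' a = if a == e then Blank else cells s2 a]).
  do ?[progress rewrite /= ?rgw2 ?d2 ?rX2 ?addn1].
  by do 2?[split; first by lia].
apply: wp_weaken (wp_vc fs2 run2) (leqnn _) _ => s3 [fs3 [cs3 rgw3 rlo3 rX3 ec3]].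
exists (3 * (hi - e.+1)).+1; last by lia.
exists e.+1; split=> //; first by lia.
move=> a; rewrite ec3 ec2 ltnS; case: (ltngtP a e) => // ae; rewrite ?andbF //.
by rewrite ae ifT //; lia.
Qed.

Lemma vc_drop_leaf n p s : n <= N -> p < 2 * n ->
  constants n s -> regs s rq = Word n.-1 -> regs s ra = Word p ->
  vc d space word drop_leaf s (fun s' =>
    [/\ constants n.-1 s', regs s' rq = Word n.-1, cells s' = cells s &
        regs s' ra = Word (if 2 * n.-1 <= p then p %/ 2 else p)]).
Proof.
move=> hn hp [c1 c2 c3] rgq rga.
do ?[progress rewrite /= ?c1 ?c2 ?c3 ?rga ?rgq].
rewrite mulnC; split; first by nia.
by case: ifP => h; do ?[split; first by nia]; rewrite ?h ?rga.
Qed.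

Lemma wp_deletion A x s : represents d A s -> size A <= N -> x \in A ->
  fits space word (call (Delete x) s) ->
  wp d space word deletion (call (Delete x) s) (2000 * size A) (fun s' =>
    represents d (rem x A) s' /\
    (1 < (size A).-1 -> reports_closest_pair d (rem x A) s')).
Proof.
move=> hr hn xA fs; set n := size A in hn *.
have n0 : 0 < n by rewrite /n; case: (A) xA.
have nn : 0 < n <= N by rewrite n0.
(* One summand per stage. The paths start at [n.-1] and at a node of number at most [2 * n.-1],
   whence the last one. *)
apply: wp_weaken (_ : wp d space word deletion (call (Delete x) s)
  (4 + ((7 * n + 3) + (16 + (48 * n + 9 + (5 + (400 * ((2 * n.-1) + n.-1) + 40)))))) _) _ _; last first.
- by move=> s'; exact.
- by lia.
have [hm hl hc] := And3 (rep_heap hr) (rep_leaves hr) (rep_consistent hr);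
  rewrite -/n in hm hl hc.
apply: wp_seq.
apply: wp_weaken (wp_frame (wp_set_constants hr hn fs)) (leqnn _) _.
move=> s1 [[fs1 cs1 ec1] fr1]; apply: wp_seq.
have r0 : regs s1 0 = Obj x by rewrite fr1.
have hl1 : leaves n (cells s1) A by rewrite ec1.
apply: wp_weaken (wp_frame (wp_find_leaf hn hl1 xA fs1 cs1 r0)) (leqnn _) _.
move=> s2 [[fs2 ec2 [p [rga2 hp ep]]] fr2]; apply: wp_seq.
have cs2 : constants n s2 by case: cs1 => *; split; rewrite fr2.
apply: wp_weaken (wp_frame (wp_vc fs2 (vc_merge_leaves nn hp cs2 rga2))) _ _ => //.
move=> s3 [[fs3 [rgq3 ec3]] fr3]; apply: wp_seq.
have cs3 : constants n s3 by case: cs2 => *; split; rewrite fr3.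
apply: wp_weaken (wp_frame (wp_release_cells nn cs3 rgq3 fs3)) (leqnn _) _.
move=> s4 [[fs4 ec4] fr4]; apply: wp_seq.
have cs4 : constants n s4 by case: cs3 => *; split; rewrite fr4.
have rga4 : regs s4 ra = Word p by rewrite fr4 // fr3.
have rgq4 : regs s4 rq = Word n.-1 by rewrite fr4.
have hp2 : p < 2 * n by lia.
apply: wp_weaken (wp_frame (wp_vc fs4 (vc_drop_leaf hn hp2 cs4 rgq4 rga4))) _ _ => //.
move=> s5 [[fs5 [cs5 rgq5 ec5 rga5]] fr5].
have hc' e : cells s5 e =
  if 8 * n.-1 ^ 2 <= e then Blank
  else if e == leaf_cell n.-1
    then (fun e => if e == leaf_cell p then cells s (leaf_cell (2 * n).-1) else cells s e)
      (leaf_cell (2 * n).-2)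
    else if e == leaf_cell p then cells s (leaf_cell (2 * n).-1) else cells s e.
  rewrite ec5 ec4 ec3 ec2 ec1; case: (leqP (8 * n.-1 ^ 2) e) => //= h1.
  (* Cells from [8 * n ^ 2] on are not touched by the release, but were blank already, and no leaf
     cell lies there. *)
  case: (leqP (8 * n ^ 2) e) => //= h2.
  have b1 : leaf_cell p < 8 * n ^ 2 by apply: leaf_cell_bound; lia.
  have b2 : leaf_cell n.-1 < 8 * n ^ 2 by apply: leaf_cell_bound; lia.
  by rewrite !ifF; [apply: (heap_blank hm)|lia|lia].
rewrite ec1 in ep.
have sz : size (rem x A) = n.-1 by rewrite size_rem.
have uA := rep_uniq hr.
have hreb := @wp_rebuild _ _ _ d dC _ _ _ hspace hword (rem x A)
  (if 2 * n.-1 <= p then p %/ 2 else p) n.-1 s5.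
rewrite sz in hreb.
apply: wp_weaken (hreb _ _ _ fs5 cs5 rga5 rgq5 _ _ _ _ _) _ _ => //.
- by lia.
- by case: ifP; lia.
- by lia.
- move=> r hr'.
  have : [&& ~~ writes drop_leaf r, ~~ writes release_cells r,
      ~~ writes merge_leaves r, ~~ writes find_leaf r & ~~ writes set_constants r].
    by move: hr'; do 20?[case: r => [|r] //].
  case/and5P => w5 w4 w3 w2 w1.
  rewrite fr5 // fr4 // fr3 // fr2 // fr1 //=; case: ifP => // _.
  by apply: (rep_regs hr); apply/eqP => h; rewrite h in hr'.
- exact: heap_mem_delete hp hc' hm.
- exact (leaves_delete hp hc' uA ep hl).
- exact: rem_uniq.
- exact: consistent_delete hp hc' hc.
- by case: ifP; lia.
Qed.

(** Each update has its own bounds, so the resting state must fit afresh: its only word is the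
    number of objects in [rN], and cells from [8 * size A ^ 2] on are blank. *)
Lemma represents_fits A s u : represents d A s -> size A <= N -> fits space word (call u s).
Proof.
move=> hr hn; split=> [r w|a w|a ha] /=.
- case: eqP => // _; have [->|ne] := eqVneq r rN.
    by case: (rep_size hr) => [|[_]] -> // [<-]; nia.
  by move: (rep_regs hr ne) => + e; rewrite e.
- by move: (heap_no_word (rep_heap hr) a) => + e; rewrite e.
- apply: (heap_blank (rep_heap hr)); apply: leq_trans ha; apply: leq_trans hspace.
  by rewrite -!mulnn; nia.
Qed.

End Programs.

Lemma represents_initial (T : eqType) (disp : Order.disp_t) (D : orderType disp)
  (d : T -> T -> D) : represents d [::] (initial T D).
Proof.
split=> //; first by right.
  by split=> *; by [left | lia | ].
Qed.

Theorem theorem2 :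
  exists (ins del : command) (C c : nat),
  forall (T : eqType) (disp : Order.disp_t) (D : orderType disp)
    (d : T -> T -> D),
    (forall x y : T, d x y = d y x) ->
  forall us : seq (update T),
    maintains d ins del
      (fun n : nat => C * n) (fun n : nat => C * n ^ 2)
      (fun n : nat => n.+1 ^ c)
      [::] (initial T D) us.
Proof.
(* The constant 2000 serves time and, since it exceeds 8, space. The exponent 9 suffices because
   [n.+1 ^ 7] is at least 128, hence above 100, for positive [n]. *)
exists insertion, deletion, 2000, 9 => T disp D d dC us.
have space_ok N : 8 * N ^ 2 <= 2000 * N ^ 2 by rewrite leq_mul.
have word_ok N : 0 < N -> 100 * N.+1 ^ 2 <= N.+1 ^ 9.
  move=> N0; rewrite (expnD _ 7 2) leq_mul //.
  by apply: (@leq_trans (2 ^ 7)) => //; rewrite leq_exp2r.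
elim: us [::] (initial T D) (represents_initial d) => [//|u us IH] A s hr /= hv.
case: u hv => x hv /=.
- rewrite (maxn_idPr (leqnSn _)).
  have fs := represents_fits (space_ok _) (word_ok (size A).+1 isT) (Insert x) hr (leqnSn _).
  have [k [s' [he hk [hr' hrep]]]] :=
    wp_insertion dC (space_ok _) (word_ok (size A).+1 isT) hr (leqnn _) hv fs.
  by exists k, s'; split=> //; apply: IH.
- have n0 : 0 < size A by case: (A) hv.
  have sz : size (rem x A) = (size A).-1 by rewrite size_rem.
  rewrite sz (maxn_idPl (leq_pred _)).
  have fs := represents_fits (space_ok _) (word_ok _ n0) (Delete x) hr (leqnn _).
  have [k [s' [he hk [hr' hrep]]]] :=
    wp_deletion dC (space_ok _) (word_ok _ n0) hr (leqnn _) hv fs.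
  by exists k, s'; split=> //; apply: IH.
Qed.
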